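(* Let $d\ge1$. For any positive real number $p$, there exist a stationary field $(X_k)_{k\in\mathbb{Z}^d}$ of independent, symmetric and $p$-integrable real random variables and a collection $\mathcal{A}$ of regular Borel subsets of $[0,1]^d$ satisfying $$\int_0^1\sqrt{H(\mathcal{A},\rho,\varepsilon)}\,d\varepsilon<+\infty$$ such that the partial sum process $\{n^{-d/2}S_n(A)\,;\,A\in\mathcal{A}\}$, $n\ge1$, is not tight in the space $C(\mathcal{A})$.
   Context: Stationary: for all $k\in\mathbb{Z}^d$, $n\ge1$ and $i_1,\dots,i_n\in\mathbb{Z}^d$, the vectors $(X_{i_1},\dots,X_{i_n})$ and $(X_{i_1+k},\dots,X_{i_n+k})$ have the same law. $p$-integrable means $E|X_0|^p<\infty$. Let $\lambda$ be Lebesgue measure on $\mathbb{R}^d$. A Borel set $A\subseteq[0,1]^d$ is regular if its boundary has Lebesgue measure zero. For $i\in\mathbb{Z}^d$, $R_i=]i_1-1,i_1]\times\dots\times]i_d-1,i_d]$. The smoothed partial sum process is $$S_n(A)=\sum_{i\in\{1,\dots,n\}^d}\lambda(nA\cap R_i)\,X_i .$$ Pseudo-metric: $\rho(A,B)=\sqrt{\lambda(A\Delta B)}$. $H(\mathcal{A},\rho,\varepsilon)=\log N(\mathcal{A},\rho,\varepsilon)$, where $N(\mathcal{A},\rho,\varepsilon)$ is the smallest number of open $\rho$-balls of radius $\varepsilon$ which form a covering of $\mathcal{A}$. $C(\mathcal{A})$ is the space of continuous real functions on $(\mathcal{A},\rho)$ with the norm $\|f\|_{\mathcal{A}}=\sup_{A\in\mathcal{A}}|f(A)|$.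 *)

(* Defs.v *)
From HB Require Import structures.
From mathcomp Require Import all_boot all_order all_algebra.
From mathcomp Require Import all_classical all_reals all_analysis.
From mathcomp Require Import measurable_realfun.

Set Implicit Arguments.
Unset Strict Implicit.
Unset Printing Implicit Defensive.

Import Order.TTheory GRing.Theory Num.Theory.
Import numFieldNormedType.Exports.
Local Open Scope classical_set_scope.
Local Open Scope ring_scope.

(* [R^d] is [d.-tuple R], with the library's product sigma-algebra, i.e. the
   Borel one. The library puts no topology on tuples: we use the (product)
   topology of row vectors, needed for boundaries of subsets of [R^d]. *)
HB.instance Definition _ (n : nat) (T : topologicalType) :=
  Topological.copy (n.-tuple T)
    (initial_topology (fun t : n.-tuple T => \row_(i < n) tnth t i)).

Section cons_measure.
Context {R : realType} (d : nat).
Local Open Scope ereal_scope.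

Definition cons_pair (z : R * d.-tuple R) : d.+1.-tuple R :=
  [tuple of z.1 :: z.2].

Lemma measurable_cons_pair : measurable_fun setT cons_pair.
Proof. exact: measurable_cons. Qed.

Definition uncons (t : d.+1.-tuple R) : R * d.-tuple R :=
  (thead t, [tuple of behead t]).

Lemma measurable_uncons : measurable_fun setT uncons.
Proof.
apply/measurable_fun_pair; first exact: measurable_tnth.
exact: measurable_behead.
Qed.

Lemma cons_pairK : cancel cons_pair uncons.
Proof. by case=> x t; congr pair => //; apply/val_inj. Qed.

Lemma unconsK : cancel uncons cons_pair.
Proof. by move=> t; apply/val_inj; rewrite /= [in RHS](tuple_eta t). Qed.

Variable m : {sigma_finite_measure set (d.-tuple R) -> \bar R}.

Definition cons_measure : set (d.+1.-tuple R) -> \bar R :=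
  pushforward (@lebesgue_measure R \x m) cons_pair.

Let cons_measure0 : cons_measure set0 = 0.
Proof. by rewrite /cons_measure /pushforward preimage_set0 measure0. Qed.

Let cons_measure_ge0 A : 0 <= cons_measure A.
Proof. exact: (measure_ge0 (@lebesgue_measure R \x m)). Qed.

Let cons_measure_sigma_additive : semi_sigma_additive cons_measure.
Proof.
have mpre A : measurable A -> measurable (cons_pair @^-1` A).
  by move=> mA; rewrite -[_ @^-1` _]setTI; exact: measurable_cons_pair.
move=> F mF tF mUF; rewrite /cons_measure /pushforward preimage_bigcup.
apply: (measure_semi_sigma_additive (s := @lebesgue_measure R \x m)).
- by move=> n; exact: mpre.
- apply/trivIsetP => /= i j _ _ ij; rewrite -preimage_setI.
  by move/trivIsetP : tF => /(_ _ _ _ _ ij) ->//; rewrite preimage_set0.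
- by rewrite -preimage_bigcup; exact: mpre.
Qed.

HB.instance Definition _ := isMeasure.Build _ _ _ cons_measure
  cons_measure0 cons_measure_ge0 cons_measure_sigma_additive.

Let cons_measure_sigma_finite : sigma_finite setT cons_measure.
Proof.
have /sigma_finiteP[F [TF ndF Foo]] := sigma_finiteT (@lebesgue_measure R).
have /sigma_finiteP[G [TG ndG Goo]] := sigma_finiteT m.
exists (fun n => uncons @^-1` (F n `*` G n)).
  rewrite -preimage_bigcup -[LHS](preimage_setT uncons); congr (_ @^-1` _).
  rewrite -setXTT TF TG predeqE => -[x y]; split.
    move=> [/= [n _ Fnx] [k _ Gky]]; exists (maxn n k) => //; split.
    - by move: x Fnx; exact/subsetPset/ndF/leq_maxl.
    - by move: y Gky; exact/subsetPset/ndG/leq_maxr.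
  by move=> [n _ []/= ? ?]; split; exists n.
move=> n; have [mF Fn] := Foo n; have [mG Gn] := Goo n; split.
  by rewrite -[_ @^-1` _]setTI; apply: measurable_uncons => //; exact: measurableX.
rewrite /cons_measure /pushforward /= -comp_preimage (_ : _ \o _ = id); last first.
  by apply/funext => z /=; exact: cons_pairK.
by rewrite preimage_id product_measure1E// lte_mul_pinfty// ge0_fin_numE.
Qed.

HB.instance Definition _ := Measure_isSigmaFinite.Build _ _ _ cons_measure
  cons_measure_sigma_finite.

End cons_measure.

(* Lebesgue measure on the Borel sets of [R^d], as an iterated product measure;
   [lebesgue_tuple_box] below gives its (characteristic) value on boxes. *)
Fixpoint lebesgue_tuple {R : realType} (d : nat) :
    {sigma_finite_measure set (d.-tuple R) -> \bar R} :=
  match d with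
  | 0 => \d_([tuple] : 0.-tuple R)
  | d'.+1 => cons_measure (lebesgue_tuple d')
  end.

Section lebesgue_tuple_theory.
Context {R : realType} (d : nat).
Local Open Scope ereal_scope.

Lemma measurable_boxed (B : 'I_d -> set R) : (forall i, measurable (B i)) ->
  measurable [set t : d.-tuple R | forall i, B i (tnth t i)].
Proof.
move=> mB.
rewrite (_ : mkset _ = \bigcap_(i in [set: 'I_d]) ((@tnth _ R ^~ i) @^-1` B i)).
  apply: fin_bigcap_measurable => // i _.
  by rewrite -[_ @^-1` _]setTI; exact: measurable_tnth.
by apply/seteqP; split => [t Bt i _|t Bt i]; [exact: Bt|exact: Bt].
Qed.

Lemma measurable_box (a b : 'I_d -> R) :
  measurable [set t : d.-tuple R | forall i, (a i < tnth t i <= b i)%R].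
Proof.
have := @measurable_boxed (fun i => `]a i, b i]%classic).
rewrite (_ : [set t | forall i, `]a i, b i]%classic (tnth t i)] =
    [set t : d.-tuple R | forall i, (a i < tnth t i <= b i)%R]); first exact.
by apply/seteqP; split => t /= h i; have := h i; rewrite in_itv.
Qed.

End lebesgue_tuple_theory.

Lemma lebesgue_tuple_box {R : realType} (d : nat) (a b : 'I_d -> R) :
  (forall i, a i <= b i) ->
  lebesgue_tuple d [set t | forall i, a i < tnth t i <= b i] =
  (\prod_i (b i - a i))%:E.
Proof.
elim: d a b => [|d IH] a b ab.
  by rewrite big_ord0 /= diracE mem_set//= => -[].
rewrite big_ord_recl EFinM.
have := IH (a \o lift ord0) (b \o lift ord0) (fun i => ab _) => /= <-.
rewrite /cons_measure /pushforward.
rewrite (_ : _ @^-1` _ = `]a ord0, b ord0]%classic `*`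
    [set t | forall i, a (lift ord0 i) < tnth t i <= b (lift ord0 i)]).
  rewrite product_measure1E//=; last exact: measurable_box.
  congr (_ * _)%E; rewrite lebesgue_measure_itv/= lte_fin.
  by have := ab ord0; rewrite le_eqVlt => /predU1P[->|->]; rewrite ?ltxx ?subrr.
apply/seteqP; split => -[x t] /=.
  move=> h; split; first by rewrite in_itv; have := h ord0.
  by move=> i; have := h (lift ord0 i); rewrite tnthS.
rewrite in_itv /= => -[h0 h] i.
by case: (unliftP ord0 i) => [j|] ->; rewrite ?tnthS.
Qed.

Lemma scaled_image_measure d1 d2 (T1 : measurableType d1)
    (T2 : measurableType d2) (R : realType) (m : {measure set T1 -> \bar R})
    (f : T1 -> T2) (k : R) : 0 <= k -> measurable_fun setT f ->
  exists mu : {measure set T2 -> \bar R}, forall A, mu A = (k%:E * m (f @^-1` A))%E.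
Proof.
move=> k0 mf.
pose fm := measure_function_pushforward__canonical__measure_function_Measure m mf.
by exists (mscale (NngNum k0) fm).
Qed.

Section dilate.
Context {R : realType}.

Definition scale_tuple d (c : R) (t : d.-tuple R) : d.-tuple R :=
  [tuple c * tnth t j | j < d].

Definition dilate d (c : R) (A : set (d.-tuple R)) : set (d.-tuple R) :=
  scale_tuple c @` A.

Lemma scale_tupleK d (c : R) : c != 0 ->
  cancel (@scale_tuple d c) (scale_tuple c^-1).
Proof.
by move=> c0 t; apply: eq_from_tnth => i; rewrite !tnth_mktuple mulKf.
Qed.

Lemma dilateE d (c : R) (A : set (d.-tuple R)) : c != 0 ->
  dilate c A = scale_tuple c^-1 @^-1` A.
Proof.
move=> c0; apply/seteqP; split => [_ [t At <-]|t At] /=.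
  by rewrite scale_tupleK.
exists (scale_tuple c^-1 t) => //.
by rewrite -{1}(invrK c) scale_tupleK ?invr_eq0.
Qed.

Lemma measurable_scale_tuple d (c : R) :
  measurable_fun setT (@scale_tuple d c).
Proof.
apply/measurable_fun_tnthP => i.
rewrite (_ : _ \o _ = (fun t : d.-tuple R => c * tnth t i)); last first.
  by apply/funext => t /=; rewrite tnth_mktuple.
exact: measurableT_comp (mulrl_measurable c) (measurable_tnth i).
Qed.

Lemma measurable_dilate d (c : R) (A : set (d.-tuple R)) : c != 0 ->
  measurable A -> measurable (dilate c A).
Proof.
move=> c0 mA; rewrite dilateE// -[_ @^-1` _]setTI.
exact: measurable_scale_tuple.
Qed.

Lemma lebesgue_measure_scale (c : R) (A : set R) : 0 < c -> measurable A ->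
  lebesgue_measure ((fun x => c^-1 * x) @^-1` A) = (c%:E * lebesgue_measure A)%E.
Proof.
move=> c0 mA.
have ci0 : 0 <= c^-1 by rewrite invr_ge0 ltW.
have mf : measurable_fun [set: measurableTypeR R]
   ((fun x => c^-1 * x) : measurableTypeR R -> measurableTypeR R).
  exact: mulrl_measurable.
have [mu muE] := scaled_image_measure (@lebesgue_measure R) ci0 mf.
have -> : lebesgue_measure A = mu A.
  apply: lebesgue_measure_unique => // _ [[a b] _ <-].
  rewrite muE /=.
  rewrite (_ : _ @^-1` _ = `]c * a, c * b]%classic); last first.
    apply/seteqP; split => x /=; rewrite !in_itv /=;
    by rewrite !ltr_pdivlMl// ?ler_pdivrMl.
  rewrite !lebesgue_measure_itv/= !lte_fin ltr_pM2l//.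
  case: ifPn => _; last by rewrite mule0.
  by rewrite -?EFinB -EFinM mulrBr !mulrA mulVf ?gt_eqF// !mul1r.
by rewrite muE /= muleA -EFinM mulfV ?gt_eqF// mul1e.
Qed.

Lemma lebesgue_dilate d (c : R) (A : set (d.-tuple R)) : 0 < c ->
  measurable A -> lebesgue_tuple d (dilate c A) = ((c ^+ d)%:E * lebesgue_tuple d A)%E.
Proof.
move=> c0; have cn0 : c != 0 by rewrite gt_eqF.
move=> mA; rewrite dilateE//; elim: d A mA => [|d IH] A mA.
  rewrite expr0 mul1e /= !diracE; congr ((nat_of_bool _)%:R)%:E.
  apply/idP/idP; rewrite !inE /=;
  by rewrite (tuple0 (scale_tuple _ _)).
pose f (z : R * d.-tuple R) := (c^-1 * z.1, scale_tuple c^-1 z.2).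
have mf : measurable_fun [set: measurableTypeR R * d.-tuple R]
    (f : measurableTypeR R * d.-tuple R -> measurableTypeR R * d.-tuple R).
  apply/measurable_fun_pair => /=.
    exact: measurableT_comp (mulrl_measurable _) measurable_fst.
  exact: measurableT_comp (measurable_scale_tuple _) measurable_snd.
have ci0 : 0 <= c^-1 ^+ d.+1 by rewrite exprn_ge0// invr_ge0 ltW.
have [mu muE] :=
  scaled_image_measure (@lebesgue_measure R \x lebesgue_tuple d)%E ci0 mf.
have mE X : measurable X -> (@lebesgue_measure R \x lebesgue_tuple d)%E X = mu X.
  apply: product_measure_unique => B C mB mC.
  rewrite muE.
  have mB' : measurable ((fun x => c^-1 * x) @^-1` B).
    by rewrite -[_ @^-1` _]setTI; exact: mulrl_measurable.
  have mC' : measurable (scale_tuple c^-1 @^-1` C).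
    by rewrite -[_ @^-1` _]setTI; exact: measurable_scale_tuple.
  have fE : f @^-1` (B `*` C) =
      ((fun x => c^-1 * x) @^-1` B) `*` (scale_tuple c^-1 @^-1` C).
    by apply/seteqP; split => -[x t].
  have E := product_measure1E (@lebesgue_measure R) (lebesgue_tuple d) mB' mC'.
  rewrite fE; apply: (etrans (congr1 (fun x => _ * x)%E E)).
  rewrite /= lebesgue_measure_scale// IH// muleACA.
  by rewrite -(EFinM c) -exprS [LHS]muleA -EFinM -exprMn mulVf// expr1n mul1e.
rewrite /= /cons_measure /pushforward /= [in RHS]mE; last first.
  by rewrite -[X in measurable X]setTI; apply: measurable_cons_pair.
rewrite muE [RHS]muleA -EFinM -exprMn mulfV// expr1n mul1e.
have fE (z : R * d.-tuple R) : scale_tuple c^-1 (cons_pair z) = cons_pair (f z).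
  apply: eq_from_tnth => i; rewrite tnth_mktuple.
  by case: (unliftP ord0 i) => [j|] ->; rewrite ?tnthS// tnth_mktuple.
have -> : @cons_pair R d @^-1` (scale_tuple c^-1 @^-1` A) =
    f @^-1` (@cons_pair R d @^-1` A).
  by apply/funext => z; rewrite /preimage /mkset fE.
by [].
Qed.

End dilate.

(* Borel subsets of [0,1]^d, a pseudometric space for [rho] below. *)
Record cube_borel (R : realType) (d : nat) := CubeBorel {
  cube_borel_set :> set (d.-tuple R);
  cube_borel_measurable : measurable cube_borel_set;
  cube_borel_sub :
    cube_borel_set `<=` [set t | forall i, 0 <= tnth t i <= 1] }.

HB.instance Definition _ (R : realType) (d : nat) :=
  gen_eqMixin (cube_borel R d).
HB.instance Definition _ (R : realType) (d : nat) :=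
  gen_choiceMixin (cube_borel R d).

Section rho.
Context {R : realType} (d : nat).
Implicit Types A B C : cube_borel R d.
Notation lambda := (lebesgue_tuple d).

Definition rho A B : R := Num.sqrt (fine (lambda (A `+` B))).

Lemma measurable_cube_borelY A B : measurable (A `+` B).
Proof.
by apply: measurableU; apply: measurableD; exact: cube_borel_measurable.
Qed.

Lemma cube_finite (D : set (d.-tuple R)) : measurable D ->
  D `<=` [set t | forall i, 0 <= tnth t i <= 1] -> lambda D \is a fin_num.
Proof.
move=> mD D01; rewrite ge0_fin_numE//.
have := @lebesgue_tuple_box R d (fun=> -1) (fun=> 1) (fun=> ltW (lt_trans (ltrN10 R) ltr01)).
move=> box; apply: (@le_lt_trans _ _
  (lambda [set t | forall i, -1 < tnth t i <= 1])); last by rewrite box ltry.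
apply: le_measure; rewrite ?inE//; first exact: measurable_box.
move=> t /D01 /= t01 i; have /andP[t0 ->] := t01 i.
by rewrite (lt_le_trans _ t0)// ltrN10.
Qed.

Lemma lambdaY_fin_num A B : lambda (A `+` B) \is a fin_num.
Proof.
apply: cube_finite; first exact: measurable_cube_borelY.
by move=> t [[/cube_borel_sub]|[/cube_borel_sub]].
Qed.

Lemma rho_sqr A B : rho A B ^+ 2 = fine (lambda (A `+` B)).
Proof. by rewrite /rho sqr_sqrtr// fine_ge0. Qed.

Lemma rhoxx A : rho A A = 0.
Proof. by rewrite /rho setYK measure0 sqrtr0. Qed.

Lemma rho_sym A B : rho A B = rho B A.
Proof. by rewrite /rho setYC. Qed.

Lemma rho_triangle B A C : rho A C <= rho A B + rho B C.
Proof.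
have rho_ge0 X Y : 0 <= rho X Y by exact: sqrtr_ge0.
rewrite -(ler_pXn2r (n := 2))// ?nnegrE ?addr_ge0//.
apply: (@le_trans _ _ (rho A B ^+ 2 + rho B C ^+ 2)); last first.
  by rewrite sqrrD lerD2r lerDl mulrn_wge0// mulr_ge0.
rewrite !rho_sqr -fineD ?lambdaY_fin_num// fine_le ?lambdaY_fin_num//.
  by rewrite fin_numD !lambdaY_fin_num.
apply: (@le_trans _ _ (lambda ((A `+` B) `|` (B `+` C)))); last first.
  by apply: measureU2; exact: measurable_cube_borelY.
apply: le_measure; rewrite ?inE.
- exact: measurable_cube_borelY.
- by apply: measurableU; exact: measurable_cube_borelY.
- by move=> t /=; have [] := pselect (cube_borel_set B t); tauto.
Qed.

Definition rho_ball A (e : R) : set (cube_borel R d) := [set B | rho A B < e].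

Definition rho_ent : set_system (cube_borel R d * cube_borel R d) :=
  entourage_ rho_ball.

Definition rho_nbhs A : set_system (cube_borel R d) := nbhs_ rho_ent A.

Let rho_nbhsE : rho_nbhs = nbhs_ rho_ent. Proof. by []. Qed.

HB.instance Definition _ := hasNbhs.Build (cube_borel R d) rho_nbhs.

Let rho_ball_center A (e : R) : 0 < e -> rho_ball A e A.
Proof. by move=> e0; rewrite /rho_ball/= rhoxx. Qed.

Let rho_ball_sym A B (e : R) : rho_ball A e B -> rho_ball B e A.
Proof. by rewrite /rho_ball/= rho_sym. Qed.

Let rho_ball_triangle A B C (e1 e2 : R) :
  rho_ball A e1 B -> rho_ball B e2 C -> rho_ball A (e1 + e2) C.
Proof.
by rewrite /rho_ball/= => ? ?; rewrite (le_lt_trans (rho_triangle B _ _))// ltrD.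
Qed.

Let rho_entE : rho_ent = entourage_ rho_ball. Proof. by []. Qed.

HB.instance Definition _ := @Nbhs_isPseudoMetric.Build R (cube_borel R d)
  rho_ent rho_nbhsE rho_ball rho_ball_center rho_ball_sym rho_ball_triangle
  rho_entE.

Lemma ball_rhoE A (e : R) : ball A e = [set B | rho A B < e].
Proof. by []. Qed.

End rho.

Section regular_entropy.
Context {R : realType} (d : nat).

Definition lebesgue_regular (A : set (d.-tuple R)) : Prop :=
  lebesgue_tuple d (closure A `\` A°) = 0%E.

(* The covering number is +oo when no finite cover exists. The balls are those
   of the pseudometric space [(A, rho)], hence centred at points of [A]. *)
Definition covering_number (A : set (cube_borel R d)) (e : R) : \bar R :=
  ereal_inf [set (n%:R)%:E | n in [set n : nat |
    exists c : 'I_n -> cube_borel R d, (forall i, A (c i)) /\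
      A `<=` \bigcup_i [set B | rho (c i) B < e]]].

Definition metric_entropy (A : set (cube_borel R d)) (e : R) : \bar R :=
  lne (covering_number A e).

End regular_entropy.

Section partial_sums.
Context {R : realType} (d : nat).
Notation lambda := (lebesgue_tuple d).

(* The unit cube R_i = ]i_1 - 1, i_1] x ... x ]i_d - 1, i_d]. *)
Definition cell (i : 'rV[int]_d) : set (d.-tuple R) :=
  [set t | forall j, (i 0 j)%:~R - 1 < tnth t j <= (i 0 j)%:~R].

(* [i : {ffun 'I_d -> 'I_n}] encodes (i_1 + 1, ..., i_d + 1) in {1,...,n}^d. *)
Definition pos_index (n : nat) (i : {ffun 'I_d -> 'I_n}) : 'rV[int]_d :=
  \row_j (i j).+1%:Z.

Definition partial_sum (x : 'rV[int]_d -> R) (n : nat) (A : cube_borel R d) : R :=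
  \sum_(i : {ffun 'I_d -> 'I_n})
    fine (lambda (dilate n%:R A `&` cell (pos_index i))) * x (pos_index i).

Lemma measurable_cell i : measurable (cell i).
Proof. exact: measurable_box. Qed.

Lemma weight_dist (c : R) (A B : cube_borel R d) i : 0 < c ->
  `|fine (lambda (dilate c A `&` cell i)) - fine (lambda (dilate c B `&` cell i))|
    <= c ^+ d * rho A B ^+ 2.
Proof.
move=> c0; have cn0 : c != 0 by rewrite gt_eqF.
suff half (X Y : cube_borel R d) :
    fine (lambda (dilate c X `&` cell i)) - fine (lambda (dilate c Y `&` cell i))
      <= c ^+ d * rho X Y ^+ 2.
  by rewrite ler_norml lerNl opprB half andbT rho_sym half.
move: A B X Y => _ _ A B.
have mU (X : cube_borel R d) : measurable (dilate c X `&` cell i).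
  apply: measurableI; last exact: measurable_cell.
  by apply: measurable_dilate => //; exact: cube_borel_measurable.
have fU (X : cube_borel R d) : lambda (dilate c X `&` cell i) \is a fin_num.
  rewrite ge0_fin_numE//; apply: (@le_lt_trans _ _ (lambda (dilate c X))).
    apply: le_measure; rewrite ?inE; [exact: mU| |exact: subIsetl].
    by apply: measurable_dilate => //; exact: cube_borel_measurable.
  rewrite lebesgue_dilate//; last exact: cube_borel_measurable.
  rewrite -ge0_fin_numE; last by rewrite mule_ge0// lee_fin exprn_ge0// ltW.
  rewrite fin_numM// cube_finite//; first exact: cube_borel_measurable.
  exact: cube_borel_sub.
have mD := measurable_dilate cn0 (measurable_cube_borelY A B).
rewrite lerBlDl rho_sqr -lee_fin EFinD EFinM !fineK ?lambdaY_fin_num//.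
rewrite -lebesgue_dilate//; last exact: measurable_cube_borelY.
apply: (@le_trans _ _
  (lambda ((dilate c B `&` cell i) `|` dilate c (A `+` B)))).
  apply: le_measure; rewrite ?inE//; first exact: measurableU.
  rewrite !dilateE// => t [/= At it].
  by have [] := pselect (cube_borel_set B (scale_tuple c^-1 t)); tauto.
exact: measureU2.
Qed.

Lemma continuous_weight (c : R) i : 0 < c ->
  continuous (fun A : cube_borel R d => fine (lambda (dilate c A `&` cell i))).
Proof.
move=> c0 A; apply/(@cvgrPdist_lt _ _ _ (nbhs A) (nbhs_filter A)) => e e0.
have cd0 : 0 < c ^+ d by rewrite exprn_gt0.
pose r := Num.min 1 (e / c ^+ d).
have r0 : 0 < r by rewrite lt_min ltr01 divr_gt0.
apply: (@filterS _ (nbhs A) _ (ball A r)); last exact: nbhsx_ballx.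
move=> B; rewrite ball_rhoE /= lt_min => /andP[AB1 ABe].
apply: le_lt_trans (weight_dist A B i c0) _.
rewrite mulrC -ltr_pdivlMr//; apply: le_lt_trans ABe.
by rewrite expr2 ler_piMl// ?sqrtr_ge0// ltW.
Qed.

Lemma dilate_card0 (c : R) (A : set (d.-tuple R)) : d = 0%N -> dilate c A = A.
Proof.
move=> d0; subst d; apply/seteqP; split => [_ [t At <-]|t At].
  by rewrite (tuple0 (scale_tuple c t)) -(tuple0 t).
by exists t => //; rewrite (tuple0 (scale_tuple c t)) -(tuple0 t).
Qed.

Lemma continuous_partial_sum (x : 'rV[int]_d -> R) (n : nat) :
  continuous (partial_sum x n).
Proof.
apply: continuous_big => [|i _ A]; first exact: add_continuous.
apply: (@cvgMr_tmp _ _ (nbhs A) (nbhs_filter A)).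
suff cw : continuous (fun B : cube_borel R d =>
    fine (lambda (dilate n%:R B `&` cell (pos_index i)))) by exact: cw.
have [n0|n0] := posnP n; last by apply: continuous_weight; rewrite ltr0n.
have d0 : d = 0%N.
  move: i; rewrite n0; case: (posnP d) => [//|d0] i.
  by case: (i (Ordinal d0)).
rewrite (_ : (fun A : cube_borel R d => _) = (fun A : cube_borel R d =>
   fine (lambda (dilate 1 A `&` cell (pos_index i))))).
  exact: continuous_weight.
by apply/funext => B; rewrite !dilate_card0.
Qed.

End partial_sums.

Section continuous_space.
Context {R : realType} (d : nat).
Import ArrowAsUniformType.

(* Continuous real functions on [(F, rho)] with the uniform topology, i.e. that
   of the sup norm, see [C_space_nbhsP]. *)
Definition C_space (F : set (cube_borel R d)) : uniformType :=
  continuousType F R.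

Lemma C_space_nbhsP (F : set (cube_borel R d)) (f : C_space F)
    (K : set (C_space F)) :
  nbhs f K <-> exists2 e : R, 0 < e &
    [set g : C_space F | forall A : F, `|(f : continuousType F R) A -
                                         (g : continuousType F R) A| < e] `<=` K.
Proof.
split.
- move=> /nbhsP [E [E' entE' sE'] sEK].
  have [P entP sP] := entE'.
  have [e /= e0 eP] : exists2 e : R, 0 < e &
      forall x y : R, `|x - y| < e -> P (x, y).
    move: entP; rewrite -entourage_ballE => -[e /= e0 sP'].
    by exists e => // x y xy; apply: sP'.
  exists e => // g fg; apply: sEK; apply/xsectionP; apply: sE'.
  by apply: sP => /= A; exact/eP/fg.
- move=> [e e0 eK]; apply/nbhsP.
  exists [set fg : C_space F * C_space F | forall A : F,
      `|(fg.1 : continuousType F R) A - (fg.2 : continuousType F R) A| < e].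
    exists [set fg : (F -> R) * (F -> R) | forall A : F,
      `|fg.1 A - fg.2 A| < e] => //.
    exists [set xy : R * R | `|xy.1 - xy.2| < e] => //.
    by rewrite -entourage_ballE; exists e.
  by move=> g /xsectionP /= fg; apply: eK.
Qed.

Variable F : set (cube_borel R d).

Definition normalized_sum_fun (x : 'rV[int]_d -> R) (n : nat) (A : F) : R :=
  n%:R `^ (- (d%:R / 2)) * partial_sum x n (set_val A).

Lemma continuous_normalized_sum_fun x n : continuous (normalized_sum_fun x n).
Proof.
move=> A; apply: (@cvgMl_tmp _ _ (nbhs A) (nbhs_filter A)).
apply: (@continuous_comp F (cube_borel R d) R set_val (partial_sum x n)).
  exact: initial_continuous.
exact: continuous_partial_sum.
Qed.

HB.instance Definition _ x n := isContinuous.Build F R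
  (normalized_sum_fun x n) (@continuous_normalized_sum_fun x n).

Definition normalized_sum (x : 'rV[int]_d -> R) (n : nat) : C_space F :=
  (normalized_sum_fun x n : continuousType F R).

End continuous_space.

Section random_fields.
Context {R : realType} {disp : measure_display} {T : measurableType disp}.
Variable P : probability T R.

(* Tightness of the laws of the [Y n], as random elements of [E]. *)
Definition tight (E : topologicalType) (Y : nat -> T -> E) : Prop :=
  forall e : R, 0 < e -> exists K : set E,
    compact K /\ forall n, ((1 - e)%:E <= P (Y n @^-1` K))%E.

Definition independent_rvs (I : choiceType) (X : I -> {RV P >-> R}) : Prop :=
  forall (s : seq I) (B : I -> set R), uniq s ->
    (forall i, measurable (B i)) ->
    P (\bigcap_(i in [set` s]) (X i @^-1` B i)) =
    (\prod_(i <- s) P (X i @^-1` B i))%E.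

Definition stationary (d : nat) (X : 'rV[int]_d -> {RV P >-> R}) : Prop :=
  forall (k : 'rV[int]_d) (n : nat) (i : 'I_n -> 'rV[int]_d)
    (B : set (n.-tuple R)), (0 < n)%N -> measurable B ->
    P [set w | B [tuple X (i j) w | j < n]] =
    P [set w | B [tuple X (i j + k) w | j < n]].

Definition symmetric_rv (X : {RV P >-> R}) : Prop :=
  forall B : set R, measurable B ->
    P [set w | B (X w)] = P [set w | B (- X w)].

End random_fields.

(* Main.v *)
(* Heavy tails beat metric entropy without inclusion.  Let X be symmetric with
   P(X = 2^l) of order 2^(-sl), where s = 2q+1 > p, so that X is p-integrable.
   On the grid of side n = 4^(sk), put l = dk and split the n^d = 2^(2sl) cells
   into m = 2^(2ql) blocks of 2^((s+1)l) cells.  Each block contains about 2^l/4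
   cells with X = 2^l, so with high probability one such cell can be selected in
   every block; the union A of the selected cells has
   S_n(A) >= m 2^l = 2^(sl) = n^(d/2), whereas rho(0, A) = 2^(-(q+1)l) tends to 0.
   This contradicts the equicontinuity at the empty set of a compact set of
   functions.  All the unions of m cells of the k-th grid number n^(dm), and
   sqrt(m log(n^d)) 2^(-(q+1)l) is of order sqrt(l) 2^(-l), which is summable in
   k: the entropy integral converges.

   The i.i.d. field lives on ]0,1] with Lebesgue measure: the random digits of a
   point are read off by an expanding piecewise affine map.  As X is
   discrete, every event depending on finitely many X_k is measurable. *)

From HB Require Import structures.
Require Import Defs.
From mathcomp Require Import all_boot all_order all_algebra.
From mathcomp Require Import all_classical all_reals all_analysis.
From mathcomp Require Import measurable_realfun.
From mathcomp Require Import ring lra zify.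
Import Order.TTheory GRing.Theory Num.Theory.
Import numFieldNormedType.Exports.
Set Implicit Arguments.
Unset Strict Implicit.
Unset Printing Implicit Defensive.
Local Open Scope classical_set_scope.
Local Open Scope ring_scope.

(** * Independent digits *)

Section countable_valued.
Context {R : realType} {disp : measure_display} {T : measurableType disp}.
Variable P : {measure set T -> \bar R}.
Implicit Types (C : countType) (E : set T).
Local Open Scope ereal_scope.

(** Encoding by [pickle] reduces countable-valued variables to [nat]-valued ones, whose events are
    countable unions of fibres. *)
Lemma preimage_countable C (V : T -> C) (Q : set C) :
  V @^-1` Q = (pickle \o V) @^-1` (pickle @` Q).
Proof.
apply/seteqP; split=> w /=; first by exists (V w).
by move=> [c Qc] /(pcan_inj pickleK) <-.
Qed.

Lemma preimage_fibers (V : T -> nat) (B : set nat) :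
  V @^-1` B = \bigcup_(n in B) (V @^-1` [set n]).
Proof.
by apply/seteqP; split=> [w Bw|w [n Bn /= ->]//]; exists (V w).
Qed.

Lemma measurable_countable C (V : T -> C) :
  (forall c, measurable (V @^-1` [set c])) ->
  forall Q, measurable (V @^-1` Q).
Proof.
move=> mV Q; rewrite preimage_countable preimage_fibers.
apply: bigcup_measurable => n _.
have [[c <-]|nc] := pselect (exists c : C, pickle c = n).
  rewrite (_ : _ @^-1` _ = V @^-1` [set c]) //.
  by apply/seteqP; split=> w /= => [/(pcan_inj pickleK)|->].
rewrite (_ : _ @^-1` _ = set0) //; apply/seteqP; split=> w //= wn.
by apply: nc; exists (V w).
Qed.

Lemma measure_fibers (V : T -> nat) E (B : set nat) :
  (forall n, measurable (V @^-1` [set n])) -> measurable E ->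
  P (V @^-1` B `&` E) =
  \sum_(n <oo | n \in B) P (V @^-1` [set n] `&` E).
Proof.
move=> mV mE; rewrite preimage_fibers setI_bigcupl measure_bigcup//.
  by move=> n _; apply: measurableI.
by apply/trivIsetP => i j _ _ ij; apply/seteqP; split => w //= -[[-> _] [ji _]];
  rewrite ji eqxx in ij.
Qed.

(** Both probabilities expand into the same series of point masses over the codes in [nat]. *)
Lemma eq_law C (V V' : T -> C) :
  (forall c, measurable (V @^-1` [set c])) ->
  (forall c, measurable (V' @^-1` [set c])) ->
  (forall c, P (V @^-1` [set c]) = P (V' @^-1` [set c])) ->
  forall Q, P (V @^-1` Q) = P (V' @^-1` Q).
Proof.
move=> mV mV' VV' Q; rewrite preimage_countable [in RHS]preimage_countable.
have mf (U : T -> C) n : (forall c, measurable (U @^-1` [set c])) ->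
    measurable ((pickle \o U) @^-1` [set n]).
  by move=> mU; rewrite comp_preimage; exact: measurable_countable.
rewrite -[LHS](congr1 P (setIT _)) -[RHS](congr1 P (setIT _)).
rewrite !measure_fibers//; [|by move=> n; apply: mf|by move=> n; apply: mf].
apply: eq_eseriesr => n /set_mem[c _ <-]; rewrite !setIT.
rewrite (_ : _ @^-1` _ = V @^-1` [set c]); last first.
  by apply/seteqP; split=> w /= => [/(pcan_inj pickleK)|->].
rewrite VV'; congr (P _).
by apply/seteqP; split=> w /= => [->|/(pcan_inj pickleK)].
Qed.

End countable_valued.

Section iid_orbit.
Context {R : realType} {disp : measure_display} {T : measurableType disp}.
Variables (P : probability T R) (N : T -> nat) (S : T -> T).
Hypothesis mN : forall n, measurable (N @^-1` [set n]).
Hypothesis mS : measurable_fun setT S.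
Hypothesis NS : forall n A, measurable A ->
  P (N @^-1` [set n] `&` S @^-1` A) = (P (N @^-1` [set n]) * P A)%E.

(** Summing [NS] over [n] shows that [S] preserves [P] and is independent of [N]; the values of [N]
    along an orbit are therefore i.i.d., like the digits of a uniform number. *)
Definition orbit_val (t : nat) (w : T) : nat := N (iter t S w).

Lemma orbit_indep1 B A : measurable A ->
  P (N @^-1` B `&` S @^-1` A) = (P (N @^-1` B) * P A)%E.
Proof.
move=> mA; have mSA : measurable (S @^-1` A) by rewrite -[_ @^-1` _]setTI; exact: mS.
rewrite measure_fibers//.
rewrite (eq_eseriesr (fun n _ => NS n mA)).
have -> : P (N @^-1` B) = (\sum_(n <oo | n \in B) P (N @^-1` [set n]))%E.
  rewrite -[N @^-1` B]setIT measure_fibers//.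
  by apply: eq_eseriesr => n _; rewrite setIT.
rewrite -(fineK (fin_num_measure P _ mA)) muleC -nneseriesZl//.
by apply: eq_eseriesr => n _; rewrite muleC.
Qed.

Lemma measurable_orbit_val t B : measurable (orbit_val t @^-1` B).
Proof.
suff mit A : measurable A -> measurable (iter t S @^-1` A).
  rewrite (_ : orbit_val t = N \o iter t S)// comp_preimage.
  exact/mit/measurable_countable.
elim: t A => [//|t IH] A mA.
rewrite (_ : _ @^-1` A = iter t S @^-1` (S @^-1` A))//.
by apply: IH; rewrite -[_ @^-1` _]setTI; exact: mS.
Qed.

(** The induction peels off time 0: the later constraints form an event pulled back by [S], which
    [orbit_indep1] decouples from [N]. *)
Lemma orbit_indep_prefix n (B : nat -> set nat) :
  P (\bigcap_(t in `I_n) (orbit_val t @^-1` B t)) =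
  (\prod_(t < n) P (N @^-1` B t))%E.
Proof.
elim: n B => [|n IH] B; first by rewrite II0 bigcap_set0 big_ord0 probability_setT.
rewrite big_ord_recl /= -(IH (fun t => B t.+1)) -orbit_indep1; last first.
  by apply: bigcap_measurableType => t _; exact: measurable_orbit_val.
congr (P _); apply/seteqP; split=> w.
  move=> Bw; split; first exact: (Bw 0%N).
  by move=> t /= tn; have := Bw t.+1 tn; rewrite /= /orbit_val iterSr.
move=> [B0 BS] [|t] //= tn; rewrite /orbit_val iterSr.
exact: (BS t tn).
Qed.

Lemma orbit_indep (I : choiceType) (f : I -> nat) (s : seq I) (B : I -> set nat) :
  injective f -> uniq s ->
  P (\bigcap_(i in [set` s]) (orbit_val (f i) @^-1` B i)) =
  (\prod_(i <- s) P (N @^-1` B i))%E.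
Proof.
move=> f_inj us.
(* The constraint at time [t]: that of the only index of [s] read at [t], or [setT] if there is
   none. The family thus becomes a prefix of times. *)
pose C t := [set x | forall i, i \in s -> f i = t -> B i x].
have Cf i : i \in s -> C (f i) = B i.
  move=> si; apply/seteqP; split=> x /=; first exact.
  by move=> Bx j _ /f_inj ->.
have CT t : t \notin map f s -> C t = setT.
  move=> ts; apply/seteqP; split=> x //= _ i si it.
  by rewrite -it map_f in ts.
pose n := (\max_(i <- s) f i).+1.
have fn i : i \in s -> (f i < n)%N.
  by move=> si; rewrite ltnS; apply: leq_bigmax_seq.
transitivity (P (\bigcap_(t in `I_n) (orbit_val t @^-1` C t))).
  congr (P _); apply/seteqP; split=> w Bw.
    by move=> t /= _ i si <-; exact: Bw.
  by move=> i /= si; have /= := Bw (f i) (fn _ si); rewrite Cf.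
rewrite orbit_indep_prefix -(big_mkord xpredT (fun t => P (N @^-1` C t))).
rewrite (bigID (mem (map f s))) /= [X in (_ * X)%E]big1 ?mule1; last first.
  by move=> t ts; rewrite CT// preimage_setT probability_setT.
rewrite -big_filter; transitivity (\prod_(t <- map f s) P (N @^-1` C t))%E.
  apply: perm_big; apply: uniq_perm.
  - by rewrite filter_uniq// iota_uniq.
  - by rewrite map_inj_uniq.
  move=> t; rewrite mem_filter mem_index_iota /=.
  apply: andb_idr => /mapP[i si ->]; exact: fn.
by rewrite big_map; apply: eq_big_seq => i si; rewrite Cf.
Qed.

(** Point masses are products in which the injective assignment of times to indices no longer
    appears. Stationarity follows by taking for [f'] a translated assignment. *)
Lemma orbit_law_inj (I : choiceType) (f f' : I -> nat) n (i : 'I_n -> I)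
    (Q : set {ffun 'I_n -> nat}) : injective f -> injective f' ->
  P [set w | Q [ffun j => orbit_val (f (i j)) w]] =
  P [set w | Q [ffun j => orbit_val (f' (i j)) w]].
Proof.
move=> f_inj f'_inj.
(* The [i j] may repeat: the constraints are grouped by distinct index. *)
pose s := undup (map i (enum 'I_n)).
pose B (c : {ffun 'I_n -> nat}) z := [set x | forall j, i j = z -> x = c j].
have fibE (g : I -> nat) (c : {ffun 'I_n -> nat}) :
    (fun w => [ffun j => orbit_val (g (i j)) w]) @^-1` [set c] =
    \bigcap_(z in [set` s]) (orbit_val (g z) @^-1` B c z).
  apply/seteqP; split=> w /=.
    by move=> <- z /= _ j <-; rewrite ffunE.
  move=> Bw; apply/ffunP => j; rewrite ffunE.
  by apply: (Bw (i j)) => //=; rewrite mem_undup map_f// mem_enum.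
have mfib (g : I -> nat) (c : {ffun 'I_n -> nat}) :
    measurable ((fun w => [ffun j => orbit_val (g (i j)) w]) @^-1` [set c]).
  rewrite fibE; apply: fin_bigcap_measurable => // z _.
  exact: measurable_orbit_val.
apply: (eq_law (V := fun w => [ffun j => orbit_val (f (i j)) w])
               (V' := fun w => [ffun j => orbit_val (f' (i j)) w])) => // c.
have us : uniq s by rewrite undup_uniq.
rewrite !fibE; apply: (etrans (orbit_indep (B c) f_inj us)).
exact/esym/(orbit_indep (B c) f'_inj us).
Qed.

End iid_orbit.

(** By uniqueness of Lebesgue measure: the image measure divided by [q] gives half-open intervals
    their length. *)
Lemma lebesgue_measure_affine (R : realType) (a q : R) (A : set R) : 0 < q ->
  measurable A ->
  lebesgue_measure ((fun u => (u - a) / q) @^-1` A) =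
  (q%:E * lebesgue_measure A)%E.
Proof.
move=> q0 mA.
have qi0 : 0 <= q^-1 by rewrite invr_ge0 ltW.
have mf : measurable_fun [set: measurableTypeR R]
   ((fun u => (u - a) / q) : measurableTypeR R -> measurableTypeR R).
  by apply: measurable_funM => //; apply: measurable_funB.
have [mu muE] := scaled_image_measure (@lebesgue_measure R) qi0 mf.
have -> : lebesgue_measure A = mu A.
  apply: lebesgue_measure_unique => // _ [[x y] _ <-].
  rewrite muE /=.
  rewrite (_ : _ @^-1` _ = `]q * x + a, q * y + a]%classic); last first.
    by apply/seteqP; split => u /=; rewrite !in_itv /=
      ltr_pdivlMr// ler_pdivrMr// ltrBrDr lerBlDr ![q * _]mulrC.
  rewrite !lebesgue_measure_itv/= !lte_fin ltrD2r ltr_pM2l//.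
  case: ifPn => _; last by rewrite mule0.
  rewrite -?EFinB -EFinM; congr EFin.
  by rewrite opprD addrACA subrr addr0 -mulrBr mulKf ?gt_eqF.
by rewrite muE /= muleA -EFinM mulfV ?gt_eqF// mul1e.
Qed.

(** * A generalised Lüroth map of the unit interval and its digits *)

Section unit_interval.
Variable R : realType.

Definition unit_lebesgue : set (measurableTypeR R) -> \bar R :=
  mrestr (@lebesgue_measure R) (@measurable_itv R `]0, 1]).

HB.instance Definition _ := Measure.on unit_lebesgue.

Let unit_lebesgue_setT : unit_lebesgue setT = 1%E.
Proof.
by rewrite /unit_lebesgue /mrestr setTI lebesgue_measure_itv/= lte_fin ltr01 oppr0 adde0.
Qed.

HB.instance Definition _ :=
  Measure_isProbability.Build _ _ _ unit_lebesgue unit_lebesgue_setT.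

Variable e : nat -> R.
Hypothesis e0 : e 0%N = 1.
Hypothesis e_dec : forall n, e n.+1 < e n.
Hypothesis e_cvg : e n @[n --> \oo] --> 0.

(* [0] is a junk value outside ]0,1]. *)
Definition digit (u : R) : nat := xget 0%N [set n | e n.+1 < u <= e n].

(** On ]0,1], the branch with digit [n] maps []e n.+1, e n]] affinely onto []0, 1]]. *)
Definition rescale (u : R) : R :=
  (u - e (digit u).+1) / (e (digit u) - e (digit u).+1).

Let e_le m n : (m <= n)%N -> e n <= e m.
Proof.
elim: n => [|n IH]; first by rewrite leqn0 => /eqP->.
rewrite leq_eqVlt => /predU1P[->//|/IH]; apply: le_trans; exact: ltW.
Qed.

Let digit_uniq n u : e n.+1 < u <= e n -> digit u = n.
Proof.
move=> un; rewrite /digit; case: xgetP => [m _ /= um|/(_ n)//].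
wlog mn : m n um un / (m < n)%N.
  move=> W; have [mn|nm|//] := ltngtP m n; first exact: W um un mn.
  by symmetry; exact: W un um nm.
have := e_le mn; move: un um => /andP[_ un] /andP[um _].
by rewrite leNgt (lt_le_trans um un).
Qed.

Let e_gt0 n : 0 < e n.
Proof.
apply: le_lt_trans (e_dec n).
rewrite -(cvg_lim _ e_cvg)//; apply: limr_le.
  by apply/cvg_ex; exists 0.
by exists n.+1 => // k /= nk; exact: e_le.
Qed.

Let digitP u : 0 < u <= 1 -> e (digit u).+1 < u <= e (digit u).
Proof.
move=> /andP[u0 u1]; rewrite /digit; case: xgetP => [m _ //|nu]; exfalso.
have ue n : u <= e n.
  elim: n => [|n IH]; first by rewrite e0.
  by rewrite leNgt; apply/negP => nu1; apply: (nu n); rewrite /= nu1.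
have : u <= 0.
  rewrite -(cvg_lim _ e_cvg)//; apply: limr_ge; first by apply/cvg_ex; exists 0.
  by exists 0%N.
by rewrite leNgt u0.
Qed.

Lemma unit_fiber n :
  digit @^-1` [set n] `&` `]0, 1]%classic = `]e n.+1, e n]%classic.
Proof.
apply/seteqP; split=> u /=; rewrite !in_itv /=; first by move=> [<- /digitP].
move=> un; split; first exact: digit_uniq.
move/andP : un => [un nu]; rewrite (lt_trans (e_gt0 _) un) (le_trans nu)//.
by rewrite -e0 e_le.
Qed.

Lemma measurable_digit n : measurable (digit @^-1` [set n]).
Proof.
have mi k : measurable ([set u | e k.+1 < u <= e k] : set R).
  rewrite (_ : mkset _ = `]e k.+1, e k]%classic); first exact: measurable_itv.
  by apply/seteqP; split=> u /=; rewrite in_itv.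
case: n => [|n].
  (* The fibre over 0 also contains the points outside ]0,1], where the digit is the junk value; it
     is described as the complement of the other fibres. *)
  rewrite (_ : _ @^-1` _ =
      ~` \bigcup_n [set u | e n.+2 < u <= e n.+1]); last first.
    apply/seteqP; split=> u /=.
      by move=> u0 [n _ /= /digit_uniq]; rewrite u0.
    rewrite /digit; case: xgetP => [[//|m] _ um nu|//]; exfalso; apply: nu.
    by exists m.
  by apply: measurableC; apply: bigcup_measurable => k _.
rewrite (_ : _ @^-1` _ = [set u | e n.+2 < u <= e n.+1])//.
apply/seteqP; split=> u /=; last exact: digit_uniq.
by rewrite /digit; case: xgetP => [m _ um <-|].
Qed.

Lemma unit_digit n : unit_lebesgue (digit @^-1` [set n]) = (e n - e n.+1)%:E.
Proof.
rewrite /unit_lebesgue /mrestr unit_fiber lebesgue_measure_itv/= lte_fin.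
by rewrite e_dec.
Qed.

Lemma measurable_rescale : measurable_fun setT (rescale : measurableTypeR R -> measurableTypeR R).
Proof.
move=> _ A mA; rewrite setTI.
rewrite (_ : _ @^-1` _ = \bigcup_n (digit @^-1` [set n] `&`
   (fun u => (u - e n.+1) / (e n - e n.+1)) @^-1` A)); last first.
  apply/seteqP; split=> u /=; first by move=> Au; exists (digit u).
  by move=> [n _ [/= <-]].
apply: bigcup_measurable => n _; apply: measurableI; first exact: measurable_digit.
rewrite -[_ @^-1` _]setTI.
by apply: measurable_funM => //; apply: measurable_funB.
Qed.

(** Each branch is affine onto ]0,1], so pulling back along it multiplies measures by the length of
    the branch, which is the mass of the digit. This is the hypothesis [NS] on orbits. *)
Lemma digit_rescale n (A : set (measurableTypeR R)) : measurable A ->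
  unit_lebesgue (digit @^-1` [set n] `&` rescale @^-1` A) =
  (unit_lebesgue (digit @^-1` [set n]) * unit_lebesgue A)%E.
Proof.
move=> mA; rewrite unit_digit /unit_lebesgue /mrestr.
have q0 : 0 < e n - e n.+1 by rewrite subr_gt0.
rewrite -(lebesgue_measure_affine (e n.+1))//; last first.
  by apply: measurableI => //; exact: measurable_itv.
congr lebesgue_measure.
rewrite setIAC unit_fiber; apply/seteqP; split=> u /=; rewrite !in_itv /=.
  move=> [un]; rewrite /rescale (digit_uniq un) => Au; split=> //.
  by rewrite ltr_pdivlMr// ler_pdivrMr// mul0r mul1r subr_gt0 lerD2r.
rewrite ltr_pdivlMr// ler_pdivrMr// mul0r mul1r subr_gt0 lerD2r => -[Au un].
by split=> //; rewrite /rescale (digit_uniq un).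
Qed.

End unit_interval.

Section geometric_series.
Variable R : realType.

Lemma nneseries_geometric_lty (u : nat -> R) (a z : R) :
  0 <= a -> 0 < z -> z < 1 -> (forall n, 0 <= u n <= a * z ^+ n) ->
  (\sum_(n <oo) (u n)%:E < +oo)%E.
Proof.
move=> a0 z0 z1 uaz.
have nz : `|z| < 1 by rewrite ger0_norm// ltW.
apply: (@le_lt_trans _ _ (a * (1 - z)^-1)%:E); last exact: ltry.
apply: lime_le; first by apply: is_cvg_nneseries => n _ _; rewrite lee_fin; case/andP: (uaz n).
apply: nearW => n; rewrite sumEFin lee_fin.
apply: le_trans (geometric_le_lim n a0 z0 nz).
by rewrite /series /=; apply: ler_sum => i _; case/andP: (uaz i).
Qed.

(** Turns a geometric bound in [n./2] into one in [n]: rounding costs at most one factor [t]. *)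
Lemma expr_half_le (t : R) (n : nat) : 0 < t -> t <= 1 ->
  (t ^+ 2) ^+ n./2 <= t^-1 * t ^+ n.
Proof.
move=> t0 t1; rewrite ler_pdivlMl// -exprM -exprS -[in leRHS](odd_double_half n).
rewrite -mul2n; case: (odd n); first by rewrite add1n.
by rewrite exprS add0n ler_piMl// exprn_ge0// ltW.
Qed.

End geometric_series.

(* The law on [nat] giving mass [2 ^- j / 4] to both [2j] and [2j + 1], through
   its tails: [tails n] is the mass of [n, +oo[. *)
Definition tails (R : realType) (n : nat) : R :=
  (if odd n then 3 / 4 else 1) * 2^-1 ^+ n./2.
Arguments tails : clear implicits.

Section tails.
Variable R : realType.

Lemma tails0 : tails R 0 = 1.
Proof. by rewrite /tails /= mul1r expr0. Qed.

Lemma tails_sub n : tails R n - tails R n.+1 = 2^-1 ^+ n./2 / 4.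
Proof.
rewrite /tails /= uphalf_half; case: (odd n) => /=.
  by rewrite add1n exprS; field.
by rewrite add0n; field.
Qed.

Lemma tails_dec n : tails R n.+1 < tails R n.
Proof. by rewrite -subr_gt0 tails_sub divr_gt0// exprn_gt0// invr_gt0. Qed.

Lemma tails_cvg : tails R n @[n --> \oo] --> 0.
Proof.
pose t : R := Num.sqrt 2^-1.
have t0 : 0 < t by rewrite sqrtr_gt0 invr_gt0.
have t2 : t ^+ 2 = 2^-1 by rewrite sqr_sqrtr// invr_ge0.
have t1 : t < 1.
  by rewrite -(@ltr_pXn2r _ 2)// ?nnegrE ?ltW// t2 expr1n; lra.
apply: (@squeeze_cvgr _ _ _ _ (fun=> 0) (geometric t^-1 t)).
- apply: nearW => n; rewrite /tails; apply/andP; split.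
    by apply: mulr_ge0; [case: ifP => _; lra|rewrite exprn_ge0// invr_ge0].
  apply: le_trans (expr_half_le n t0 (ltW t1)); rewrite t2 ler_piMl//.
  by case: ifP => _; lra.
- exact: cvg_cst.
- by apply: cvg_geometric; rewrite ger0_norm// ltW.
Qed.

End tails.

(** * Independent coordinates indexed by a countable type *)

Section field.
Variables (R : realType) (I : countType).
Notation P := (@unit_lebesgue R).

Definition coord (i : I) : R -> nat :=
  orbit_val (digit (tails R)) (rescale (tails R)) (pickle i).

Let P' : probability (measurableTypeR R) R := P.

Let mN n : measurable (digit (tails R) @^-1` [set n] : set (measurableTypeR R)).
Proof. exact: (measurable_digit (@tails_dec R)). Qed.

Let mS := measurable_rescale (@tails_dec R).

Let NS n (A : set (measurableTypeR R)) : measurable A ->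
  P' (digit (tails R) @^-1` [set n] `&` rescale (tails R) @^-1` A) =
  (P' (digit (tails R) @^-1` [set n]) * P' A)%E.
Proof. exact: (digit_rescale (@tails0 R) (@tails_dec R) (@tails_cvg R)). Qed.

Lemma measurable_coord i B : measurable (coord i @^-1` B : set (measurableTypeR R)).
Proof. exact: (@measurable_orbit_val _ (measurableTypeR R)). Qed.

Lemma digit_law n : P (digit (tails R) @^-1` [set n]) = (2^-1 ^+ n./2 / 4)%:E.
Proof.
by rewrite (unit_digit (@tails0 R) (@tails_dec R) (@tails_cvg R)) tails_sub.
Qed.

Let coord_bigcap (s : seq I) (B : I -> set nat) : uniq s ->
  P (\bigcap_(i in [set` s]) (coord i @^-1` B i)) =
  (\prod_(i <- s) P (digit (tails R) @^-1` B i))%E.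
Proof. by move=> us; apply: (orbit_indep mN mS NS) => //; exact: (pcan_inj pickleK). Qed.

Lemma coord_lawE i B : P (coord i @^-1` B) = P (digit (tails R) @^-1` B).
Proof.
have := @coord_bigcap [:: i] (fun=> B) isT; rewrite big_seq1 => <-; congr P.
apply/seteqP; split=> w /=; first by move=> Bw j /=; rewrite inE => /eqP->.
by move/(_ i); apply; rewrite /= inE.
Qed.

Lemma coord_law i n : P (coord i @^-1` [set n]) = (2^-1 ^+ n./2 / 4)%:E.
Proof. by rewrite coord_lawE digit_law. Qed.

Lemma coord_indep (s : seq I) (B : I -> set nat) : uniq s ->
  P (\bigcap_(i in [set` s]) (coord i @^-1` B i)) =
  (\prod_(i <- s) P (coord i @^-1` B i))%E.
Proof. by move=> us; rewrite coord_bigcap//; apply: eq_bigr => i _; rewrite coord_lawE. Qed.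

Lemma coord_law_inj (f : I -> I) n (i : 'I_n -> I) (Q : set {ffun 'I_n -> nat}) :
  injective f ->
  P [set w | Q [ffun j => coord (i j) w]] =
  P [set w | Q [ffun j => coord (f (i j)) w]].
Proof.
move=> f_inj; apply: (@orbit_law_inj _ _ _ P' _ _ mN mS NS I pickle (pickle \o f)).
  exact: (pcan_inj pickleK).
exact: inj_comp (pcan_inj pickleK) f_inj.
Qed.

(** The vector of coordinates takes countably many values, so [Q] may be arbitrary; this later
    covers preimages of arbitrary sets of functions. *)
Lemma measurable_coords (J : finType) (i : J -> I) (Q : set {ffun J -> nat}) :
  measurable ([set w | Q [ffun j => coord (i j) w]] : set (measurableTypeR R)).
Proof.
apply: (measurable_countable (V := fun w => [ffun j => coord (i j) w])) => c.
rewrite (_ : _ @^-1` _ = \bigcap_(j in [set: J]) (coord (i j) @^-1` [set c j])).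
  by apply: fin_bigcap_measurable => // j _; exact: measurable_coord.
apply/seteqP; split=> w /=; first by move=> <- j _ /=; rewrite ffunE.
by move=> wc; apply/ffunP => j; rewrite ffunE; exact: wc.
Qed.

End field.

(** * The heavy-tailed symmetric field *)

Section heavy_tailed_field.
Variables (R : realType) (d s : nat).
Notation P := (@unit_lebesgue R).
Notation I := 'rV[int]_d.

(** The parity of [n] is the sign and [j = n./2] fixes the modulus [2^(j/s)], which has probability
    [2^-j / 2] under the law of the digits. Hence, for [s > 0], a modulus of at least [2^(j/s)] has
    probability [2^-j]: a tail of index [s]. *)
Definition amplitude (n : nat) : R := (-1) ^+ odd n * (2 `^ s%:R^-1) ^+ n./2.

Definition flip (n : nat) : nat := if odd n then n.-1 else n.+1.

Lemma half_flip n : (flip n)./2 = n./2.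
Proof. by rewrite /flip; case: ifP => on; lia. Qed.

Lemma odd_flip n : odd (flip n) = ~~ odd n.
Proof. by rewrite /flip; case: ifP => on; lia. Qed.

Lemma flipK : involutive flip.
Proof.
by move=> n; rewrite -(odd_double_half (flip (flip n))) !half_flip !odd_flip negbK odd_double_half.
Qed.

Lemma amplitude_flip n : amplitude (flip n) = - amplitude n.
Proof. by rewrite /amplitude odd_flip half_flip signrN mulNr. Qed.

Lemma norm_amplitude n : `|amplitude n| = (2 `^ s%:R^-1) ^+ n./2.
Proof. by rewrite normrM normr_sign mul1r ger0_norm// exprn_ge0// powR_ge0. Qed.

Lemma amplitude_double k : (0 < s)%N -> amplitude (s * k).*2 = 2 ^+ k.
Proof.
move=> s0; rewrite /amplitude odd_double doubleK mul1r exprM; congr (_ ^+ _).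
by rewrite -powR_mulrn// -powRrM mulVf ?pnatr_eq0 -?lt0n// powRr1.
Qed.

Definition field_fun (k : I) (w : measurableTypeR R) : R := amplitude (coord k w).

Lemma measurable_field_fun k : measurable_fun setT (field_fun k).
Proof.
move=> _ B mB; rewrite setTI.
exact: (measurable_coord k (amplitude @^-1` B)).
Qed.

HB.instance Definition _ k :=
  isMeasurableFun.Build _ _ _ _ (field_fun k) (measurable_field_fun k).

Definition field (k : I) : {RV P >-> R} := field_fun k.

Lemma field_stationary : stationary field.
Proof.
move=> k n i B n0 mB.
have := @coord_law_inj R I (+%R^~ k) n i
  [set c | B [tuple amplitude (c j) | j < n]] (addIr k).
have E (g : 'I_n -> I) : [set w | B [tuple field (g j) w | j < n]] =
  [set w | [set c : {ffun 'I_n -> nat} | B [tuple amplitude (c j) | j < n]]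
     [ffun j => coord (g j) w]].
  apply/funext => w /=; congr B.
  by apply: eq_from_tnth => j; rewrite !tnth_mktuple ffunE.
by rewrite !E.
Qed.

Lemma field_independent : independent_rvs field.
Proof.
move=> t B ut mB.
exact: (@coord_indep R I t (fun k => amplitude @^-1` B k) ut).
Qed.

(** [flip] reverses the sign of the amplitude and keeps [n./2], hence the point masses: the
    coordinate and its flip have the same law. *)
Lemma field_symmetric k : symmetric_rv (field k).
Proof.
move=> B mB.
have mV c : measurable (coord k @^-1` [set c] : set (measurableTypeR R)).
  exact: measurable_coord.
have fibE c : (flip \o coord k) @^-1` [set c] = coord (R := R) k @^-1` [set flip c].
  by apply/seteqP; split=> w /= => [<-|->]; rewrite flipK.
have := @eq_law R _ _ P _ (coord k) (flip \o coord k) mV _ _ (amplitude @^-1` B).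
rewrite /= => ->.
- by congr P; apply/seteqP; split => w /=; rewrite amplitude_flip.
- by move=> c; rewrite fibE.
- move=> c; rewrite fibE.
  have := @coord_law R I k (flip c); rewrite half_flip -(@coord_law R I k c).
  by move=> h; exact/esym.
Qed.

Lemma field_integrable (p : R) : 0 < p -> p < s%:R ->
  ('E_P[(fun w => `|field 0 w| `^ p)%R] < +oo)%E.
Proof.
move=> p0 ps; have s0 : 0 < (s%:R : R) by exact: lt_trans ps.
(* When [n./2] grows by one, the [p]-th power of the modulus is multiplied by [2^(p/s)] and the mass
   is halved; [th < 1] because [p < s]. Its square root [t] serves as a ratio in [n] instead of
   [n./2]. *)
pose th : R := 2 `^ (p / s%:R) / 2.
have th0 : 0 < th by rewrite divr_gt0// powR_gt0.
have th1 : th < 1.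
  rewrite ltr_pdivrMr// mul1r /powR pnatr_eq0 /= -[ltRHS]lnK ?posrE//.
  by rewrite ltr_expR gtr_pMl ?ln_gt0 ?ltr1n// ltr_pdivrMr// mul1r.
pose t := Num.sqrt th.
have t0 : 0 < t by rewrite sqrtr_gt0.
have t2 : t ^+ 2 = th by rewrite sqr_sqrtr// ltW.
have t1 : t < 1 by rewrite -(@ltr_pXn2r _ 2)// ?nnegrE ?ltW// t2 expr1n.
pose D n := coord (R := R) (0 : I) @^-1` [set n].
have mD n : measurable (D n : set (measurableTypeR R)) by exact: measurable_coord.
have DT : [set: measurableTypeR R] = \bigcup_n D n.
  by apply/seteqP; split=> w // _; exists (coord (0 : I) w).
rewrite unlock DT ge0_integral_bigcup//; last 2 first.
- rewrite -DT; apply/measurable_EFinP.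
  apply: (measurableT_comp (f := fun x => x `^ p)) => //.
  exact: measurableT_comp.
- apply/trivIsetP => i j _ _ ij; apply/seteqP; split => w //= -[wi wj].
  by move: ij; rewrite -[i]wi -[j]wj eqxx.
rewrite (eq_eseriesr (g := fun n => (th ^+ n./2 / 4)%:E)); last first.
  move=> n _; rewrite (eq_integral (cst (((2 `^ s%:R^-1) ^+ n./2) `^ p)%:E)).
    rewrite integral_cst// [X in (_ * X)%E](@coord_law R I (0 : I) n) -EFinM.
    have -> : ((2 `^ s%:R^-1) ^+ n./2) `^ p = (2 `^ (p / s%:R)) ^+ n./2 :> R.
      rewrite -[in LHS](powR_mulrn _ (powR_ge0 2 _)).
      rewrite -[in RHS](powR_mulrn _ (powR_ge0 2 _)) -!powRrM.
      by rewrite [_ * p]mulrC mulrA [_ * p]mulrC.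
    by rewrite mulrA -exprMn.
  move=> w /set_mem wn; rewrite /= /field /field_fun norm_amplitude.
  by rewrite wn.
have ti0 : 0 <= t^-1 by rewrite invr_ge0 ltW.
apply: (nneseries_geometric_lty ti0 t0 t1) => n.
have thn : 0 <= th ^+ n./2 by rewrite exprn_ge0// ltW.
apply/andP; split; first by rewrite divr_ge0.
have := expr_half_le n t0 (ltW t1); rewrite t2; apply: le_trans.
by rewrite ler_pdivrMr// ler_peMr//; lra.
Qed.

End heavy_tailed_field.

(** * Cells and regularity *)

Section tuple_topology.
Variables (R : realType) (d : nat).
Implicit Type t : d.-tuple R.

Lemma tnth_continuous (i : 'I_d) : continuous (fun t => tnth t i).
Proof.
move=> t; rewrite (_ : (fun _ => _) =
    (fun M : 'rV[R]_d => M 0 i) \o (fun t => \row_(i < d) tnth t i)).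
  apply: continuous_comp; first exact: initial_continuous.
  exact: coord_continuous.
by apply/funext => u /=; rewrite mxE.
Qed.

Lemma open_tuple_box (O : set (d.-tuple R)) t : open O -> O t ->
  exists2 e : R, 0 < e & forall u, (forall i, `|tnth t i - tnth u i| < e) -> O u.
Proof.
move=> [U oU <-] /= Ut.
have /nbhs_ballP[e /= e0 eU] := open_nbhs_nbhs (conj oU Ut).
exists e => // u tu; apply: eU; split=> // i j.
by rewrite !mxE; exact: tu.
Qed.

(** Relates the topology of row vectors to the product sigma-algebra: an open set is the union of
    the countably many half-open boxes with rational corners that it contains. *)
Lemma measurable_open_tuple (O : set (d.-tuple R)) : open O -> measurable O.
Proof.
move=> oO.
pose box (c : {ffun 'I_d -> rat} * {ffun 'I_d -> rat}) : set (d.-tuple R) :=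
  [set t | forall i, ratr (c.1 i) < tnth t i <= ratr (c.2 i)].
rewrite (_ : O = \bigcup_(c in [set: {ffun 'I_d -> rat} * {ffun 'I_d -> rat}])
    (if `[<box c `<=` O>] then box c else set0)).
  apply: countable_bigcupT_measurable => [|c]; first exact: countableP.
  by case: ifP => // _; exact: measurable_box.
apply/seteqP; split=> t; last first.
  move=> [c _]; case: ifPn; first by move=> h ct; apply: (asboolW h).
  by move=> _ ct; case: ct.
move=> Ot; have [e e0 eO] := open_tuple_box oO Ot.
have low i : exists r : rat, tnth t i - e < ratr r < tnth t i.
  have /rat_in_itvoo[r] : tnth t i - e < tnth t i by rewrite ltrBlDr ltrDl.
  by rewrite in_itv /= => ri; exists r.
have upp i : exists r : rat, tnth t i < ratr r < tnth t i + e.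
  have /rat_in_itvoo[r] : tnth t i < tnth t i + e by rewrite ltrDl.
  by rewrite in_itv /= => ri; exists r.
pose a := [ffun i => sval (cid (low i))]; pose b := [ffun i => sval (cid (upp i))].
have aP i : tnth t i - e < ratr (a i) < tnth t i by rewrite ffunE; case: cid.
have bP i : tnth t i < ratr (b i) < tnth t i + e by rewrite ffunE; case: cid.
exists (a, b) => //; rewrite ifT.
  move=> i /=; have /andP[_ ->] := aP i; have /andP[/ltW -> _] := bP i.
  by [].
apply/asboolP => u ub; apply: eO => i.
have /= := ub i; have := aP i; have := bP i => /andP[_ bi] /andP[ai _] /andP[ui iu].
by rewrite ltr_distlC; apply/andP; split; [exact: lt_trans ui|exact: le_lt_trans bi].
Qed.

Lemma measurable_boundary (A : set (d.-tuple R)) :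
  measurable (closure A `\` A°).
Proof.
apply: measurableD; last first.
  by apply: measurable_open_tuple; exact: open_interior.
rewrite -[closure A]setCK; apply: measurableC; apply: measurable_open_tuple.
by apply: closed_openC; exact: closed_closure.
Qed.

End tuple_topology.

(** Splitting off the first coordinate exhibits a product with a null factor; the other factor has
    infinite measure or not, as [0 * +oo = 0]. *)
Lemma lebesgue_tuple_null_coord (R : realType) (d : nat) (Z : set R) (j : 'I_d) :
  measurable Z -> lebesgue_measure Z = 0%E ->
  lebesgue_tuple d [set t | Z (tnth t j)] = 0%E.
Proof.
move=> mZ Z0; elim: d j => [[]//|d IH] j.
rewrite /= /cons_measure /pushforward.
case: (unliftP ord0 j) => [k|] ->.
  rewrite (_ : _ @^-1` _ = setT `*` [set t | Z (tnth t k)]); last first.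
    by apply/seteqP; split => -[x t] /=; rewrite tnthS => // -[].
  rewrite product_measure1E//= ?IH ?mule0//.
  by rewrite -[X in measurable X]setTI; exact: measurable_tnth.
rewrite (_ : _ @^-1` _ = Z `*` setT); last first.
  by apply/seteqP; split => -[x t] //= [].
by rewrite product_measure1E//= Z0 mul0e.
Qed.

Section cells.
Variables (R : realType) (d : nat).
Implicit Types (t : d.-tuple R) (i : 'rV[int]_d).

Let ceilE (x : R) k : (Num.ceil x == k) = (k%:~R - 1 < x <= k%:~R).
Proof. by rewrite ceil_eq intrB. Qed.

(** Cells are the fibres of the coordinatewise ceiling: this gives both their disjointness and the
    local constancy of the cell index off the integer hyperplanes. *)
Lemma cell_ceil i t : cell i t <-> forall j, i 0 j = Num.ceil (tnth t j).
Proof.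
split=> h j; first by apply/esym/eqP; rewrite ceilE; exact: h.
by rewrite h -ceilE.
Qed.

Lemma cell_inj i i' t : cell i t -> cell i' t -> i = i'.
Proof. by move=> /cell_ceil h /cell_ceil h'; apply/rowP => j; rewrite h h'. Qed.

Lemma lebesgue_cell i : lebesgue_tuple d (@cell R d i) = 1%E.
Proof.
rewrite lebesgue_tuple_box; last by move=> j; rewrite gerBl.
by rewrite big1// => j _; rewrite opprB addrC subrK.
Qed.

(** At a boundary point some [c * tnth t j] is an integer, since elsewhere the cell is locally
    constant. Such points lie in finitely many null sets, one per coordinate. *)
Lemma regular_cells (c : R) (J : set 'rV[int]_d) : 0 < c ->
  lebesgue_regular (scale_tuple c @^-1` (\bigcup_(i in J) cell i)).
Proof.
move=> c0; set A := _ @^-1` _.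
pose Z : set R := [set x | c * x \is a Num.int].
have Zcnt : countable Z.
  rewrite (_ : Z = (fun k : int => k%:~R / c) @` setT).
    by apply: (sub_countable (card_image_le _ _)); exact: countableP.
  apply/seteqP; split=> x /=; first by move=> /intrP[k ck]; exists k => //; rewrite -ck mulrAC mulfV ?mul1r ?gt_eqF.
  by move=> [k _ <-]; rewrite /Z /= mulrCA mulfV ?gt_eqF// mulr1.
have mZ : measurable Z by exact: countable_measurable.
have Z0 : lebesgue_measure Z = 0%E by exact: countable_lebesgue_measure0.
apply: measure_negligible; first exact: measurable_boundary.
(* The union over ['I_d] is written over [nat], padded with empty sets, so that countable unions of
   negligible sets apply. *)
have nB : (lebesgue_tuple d).-negligible (\bigcup_k
    (if insub k is Some j then [set t : d.-tuple R | Z (tnth t (j : 'I_d))]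
     else set0)).
  apply: negligible_bigcup => k; case: insubP => [j _ _|_]; last exact: negligible_set0.
  exists [set t | Z (tnth t j)]; split=> //; last exact: lebesgue_tuple_null_coord.
  by rewrite -[X in measurable X]setTI; exact: measurable_tnth.
apply: negligibleS nB.
move=> t [clA niA]; apply: contrapT => nZ; apply: niA.
have tZ j : c * tnth t j \isn't a Num.int.
  apply/negP => tj; apply: nZ; exists (j : nat) => //.
  by rewrite valK.
pose m j : R := (Num.ceil (c * tnth t j))%:~R.
pose U := [set u : d.-tuple R | forall j, m j - 1 < c * tnth u j < m j].
have Ut : nbhs t U.
  apply: (@filter_forall _ _ (fun j => [set u : d.-tuple R |
    m j - 1 < c * tnth u j < m j]) (nbhs t) (nbhs_filter t)) => j.
  have : tnth t j \in `](m j - 1) / c, m j / c[.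
    rewrite in_itv /= ltr_pdivrMr// ltr_pdivlMr// ![_ * c]mulrC.
    have := ceilE (c * tnth t j) (Num.ceil (c * tnth t j)); rewrite eqxx.
    move=> /esym/andP[-> tm]; rewrite lt_neqAle tm andbT.
    by apply: contra (tZ j) => /eqP ->; exact: intr_int.
  move=> /near_in_itvoo /(@tnth_continuous R d j t).
  apply: (@filterS _ (nbhs t) (nbhs_filter t)) => u /=.
  by rewrite in_itv /= ltr_pdivrMr// ltr_pdivlMr// ![_ * c]mulrC.
(* As [t] is in the closure, [U] meets the set; all of [U] lies in the cell of that point, which
   makes [t] interior. *)
have [u [[i Ji iu] Uu]] := clA _ Ut.
apply: (@filterS _ (nbhs t) (nbhs_filter t) _ _ _ Ut) => v Uv; exists i => //.
have ceilU w j : U w -> Num.ceil (c * tnth w j) = Num.ceil (c * tnth t j).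
  move=> /(_ j) /= /andP[w1 w2]; apply/eqP; rewrite ceilE.
  by rewrite w1 ltW.
apply/cell_ceil => j; move/cell_ceil : iu => /(_ j) ->.
by rewrite !tnth_mktuple !ceilU.
Qed.

End cells.

Section grid_sets.
Variables (R : realType) (d : nat).

Lemma pos_index_inj n : injective (@pos_index d n).
Proof.
move=> i i' /rowP h; apply/ffunP => j; apply/val_inj.
by have := h j; rewrite !mxE => -[].
Qed.

Definition cube0 : cube_borel R d := CubeBorel measurable0 (@sub0set _ _).

Variable n : nat.
Implicit Types s : seq {ffun 'I_d -> 'I_n.+1}.

Definition cells s : set (d.-tuple R) :=
  \bigcup_(i in [set` map (@pos_index d n.+1) s]) cell i.

Lemma measurable_cells s : measurable (cells s).
Proof. by apply: fin_bigcup_measurable => // i _; exact: measurable_cell. Qed.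

Lemma measurable_grid s : measurable (scale_tuple n.+1%:R @^-1` cells s).
Proof.
rewrite -[_ @^-1` _]setTI; apply: measurable_scale_tuple => //.
exact: measurable_cells.
Qed.

Lemma grid_sub_cube s :
  scale_tuple n.+1%:R @^-1` cells s `<=` [set t : d.-tuple R | forall i, 0 <= tnth t i <= 1].
Proof.
move=> t [_ /mapP[i _ ->] it] j; have := it j; rewrite mxE tnth_mktuple.
have n0 : 0 < n.+1%:R :> R by rewrite ltr0n.
rewrite -[((i j).+1%:Z)%:~R]/((i j).+1%:R : R) => /andP[i1 i2]; apply/andP; split.
  rewrite -(pmulr_rge0 _ n0) (le_trans _ (ltW i1))// -natr1 addrK ler0n //.
rewrite -(ler_pM2l n0) mulr1 (le_trans i2)// ler_nat; exact: ltn_ord.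
Qed.

Definition grid_set s : cube_borel R d :=
  CubeBorel (measurable_grid s) (@grid_sub_cube s).

Let n0 : 0 < n.+1%:R :> R. Proof. by rewrite ltr0n. Qed.

Lemma regular_grid s : lebesgue_regular (grid_set s).
Proof. exact: regular_cells. Qed.

Lemma dilate_grid s : dilate n.+1%:R (grid_set s) = cells s.
Proof.
rewrite dilateE ?gt_eqF// /= -comp_preimage; apply/seteqP; split=> t /=;
by rewrite -{1}[n.+1%:R]invrK scale_tupleK ?invr_eq0 ?gt_eqF.
Qed.

Lemma lebesgue_cells_le s : (lebesgue_tuple d (cells s) <= (size s)%:R%:E)%E.
Proof.
rewrite /cells bigcup_seq; elim: s => [|i s IH]; first by rewrite big_nil measure0.
rewrite /= big_cons -bigcup_seq.
have := measureU2 (lebesgue_tuple d) (@measurable_cell R d (pos_index i))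
  (measurable_cells s).
move=> /le_trans; apply; rewrite -nat1r EFinD; apply: leeD.
  by rewrite [leLHS]lebesgue_cell.
by rewrite /cells bigcup_seq.
Qed.

(** Each rescaled cell has volume [n.+1 ^- d]; the bound is not an equality because [s] may repeat
    cells. *)
Lemma rho_grid s : rho cube0 (grid_set s) ^+ 2 <= (size s)%:R / n.+1%:R ^+ d.
Proof.
rewrite rho_sqr set0Y ler_pdivlMr ?exprn_gt0// mulrC -lee_fin EFinM fineK.
  rewrite -lebesgue_dilate//; last exact: cube_borel_measurable.
  by rewrite dilate_grid lebesgue_cells_le.
exact: (cube_finite (cube_borel_measurable _) (@cube_borel_sub _ _ _)).
Qed.

Lemma partial_sum0 (x : 'rV[int]_d -> R) : partial_sum x n.+1 cube0 = 0.
Proof.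
rewrite /partial_sum big1// => i _; rewrite /dilate image_set0 set0I measure0.
by rewrite mul0r.
Qed.

(** The smoothing weights are 1 on selected cells and 0 on the others, which are disjoint from
    them. *)
Lemma partial_sum_grid (x : 'rV[int]_d -> R) s : uniq s ->
  partial_sum x n.+1 (grid_set s) = \sum_(i <- s) x (pos_index i).
Proof.
move=> us; rewrite big_uniq//= /partial_sum (bigID (mem s)) /= [X in _ + X]big1 ?addr0.
  apply: eq_bigr => i si; rewrite dilate_grid setIidr ?lebesgue_cell ?mul1r//.
  by move=> t it; exists (pos_index i) => //=; rewrite map_f.
move=> i nis; rewrite dilate_grid (_ : _ `&` _ = set0) ?measure0 ?mul0r//.
apply/seteqP; split=> // t [[_ /mapP[i' si' ->] i't] it].
by move: nis; rewrite (pos_index_inj (cell_inj it i't)) si'.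
Qed.

End grid_sets.

(** * Metric entropy *)

(* Unlike [ge0_le_integral], no measurability: that of the entropy need not be
   examined. *)
Lemma nonneg_le_integral (disp : measure_display) (T : measurableType disp)
    (R : realType) (mu : {measure set T -> \bar R}) (D : set T) (f g : T -> \bar R) :
  (forall x, D x -> 0 <= f x)%E -> (forall x, D x -> f x <= g x)%E ->
  (\int[mu]_(x in D) f x <= \int[mu]_(x in D) g x)%E.
Proof.
move=> f0 fg; rewrite !ge0_integralE//; last first.
  by move=> x Dx; apply: le_trans (fg x Dx); exact: f0.
apply: ge_ereal_sup => _ [h hf <-]; apply: ereal_sup_ubound; exists h => // x.
apply: le_trans (hf x) _; rewrite /patch; case: ifPn => // /set_mem Dx.
exact: fg.
Qed.

Lemma ln_prod_nat (R : realType) (K : nat -> nat) k :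
  (ln (\prod_(j < k) (K j).+1)%:R : R) = \sum_(j < k) ln (K j).+1%:R.
Proof.
elim: k => [|k IH]; first by rewrite !big_ord0 ln1.
by rewrite !big_ord_recr /= natrM lnM ?IH// posrE ltr0n// prodn_gt0.
Qed.

(** Bounds the size of a net by a product, whose logarithm splits over the levels. *)
Lemma sum_lt_prod (K : nat -> nat) k :
  (\sum_(j < k) K j < \prod_(j < k) (K j).+1)%N.
Proof.
elim: k => [|k IH]; first by rewrite !big_ord0.
rewrite !big_ord_recr /= mulnS -addSn leq_add// leq_pmull//.
by rewrite prodn_gt0.
Qed.

Lemma sqrtr_sum_le (R : realType) (u : nat -> R) k : (forall j, 0 <= u j) ->
  Num.sqrt (\sum_(j < k) u j) <= \sum_(j < k) Num.sqrt (u j).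
Proof.
move=> u0; elim: k => [|k IH]; first by rewrite !big_ord0 sqrtr0.
rewrite !big_ord_recr /=; set a := \sum_(_ < _) u _ in IH *.
have a0 : 0 <= a by apply: sumr_ge0.
apply: le_trans (lerD IH (lexx _)).
rewrite -(@ler_pXn2r _ 2)// ?nnegrE ?addr_ge0// sqrrD !sqr_sqrtr ?addr_ge0//.
by rewrite lerD2r lerDl mulrn_wge0// mulr_ge0.
Qed.

Section concentrating_families.
Variables (R : realType) (d : nat).
Variables (A0 : cube_borel R d) (J : nat -> finType)
  (C : forall k, J k -> cube_borel R d).

Definition family_union : set (cube_borel R d) :=
  [set A | A = A0 \/ exists k, exists i : J k, A = C i].

Variable eps : nat -> R.
Hypothesis rho_eps : forall k (i : J k), rho A0 (C i) <= eps k.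

(** The ball around [A0] absorbs all levels from [k] on; each member of a lower level is its own
    centre. *)
Lemma covering_family (e : R) k : 0 < e -> (forall j, (k <= j)%N -> eps j < e) ->
  (covering_number family_union e <= (\prod_(j < k) #|J j|.+1)%:R%:E)%E.
Proof.
move=> e0 ek.
pose L := A0 :: flatten [seq [seq C i | i <- enum (J j)] | j <- iota 0 k].
have LF : forall A, A \in L -> family_union A.
  move=> A; rewrite inE => /predU1P[->|]; first by left.
  by move=> /flattenP[_ /mapP[j _ ->] /mapP[i _ ->]]; right; exists j, i.
have sL : (size L <= \prod_(j < k) #|J j|.+1)%N.
  rewrite /= size_flatten /shape -map_comp sumnE big_map.
  rewrite (eq_bigr (fun j => #|J j|)); last by move=> j _; rewrite /= size_map -cardE.
  have := sum_lt_prod (fun j => #|J j|) k.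
  by rewrite -(big_mkord xpredT (fun j => #|J j|)) /index_iota subn0.
apply: (@le_trans _ _ (size L)%:R%:E); last by rewrite lee_fin ler_nat.
apply: ereal_inf_lbound; exists (size L) => //; exists (fun i => nth A0 L i).
split=> [i|A FA]; first by by apply: LF; rewrite mem_nth.
have in_L B D : B \in L -> rho B D < e ->
    (\bigcup_(i in [set: 'I_(size L)]) [set D' | rho (nth A0 L i) D' < e]) D.
  move=> BL BD; have iL : (index B L < size L)%N by rewrite index_mem.
  by exists (Ordinal iL) => //=; rewrite nth_index.
case: FA => [->|[j [i ->]]]; first by apply: (in_L A0); rewrite ?mem_head ?rhoxx.
have [kj|jk] := leqP k j.
  apply: (in_L A0); first exact: mem_head.
  exact: le_lt_trans (rho_eps i) (ek j kj).
apply: (in_L (C i)); last by rewrite rhoxx.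
rewrite inE; apply/orP; right; apply/flattenP.
exists [seq C i | i <- enum (J j)]; last by rewrite map_f// mem_enum.
by apply/mapP; exists j => //; rewrite mem_iota.
Qed.

Hypothesis eps_decr : forall j k, (j <= k)%N -> eps k <= eps j.
Hypothesis eps_gt0 : forall k, 0 < eps k.
Variables (a z : R).
Hypotheses (a0 : 0 <= a) (z0 : 0 < z) (z1 : z < 1).

Let w k : R := Num.sqrt (ln #|J k|.+1%:R).

Hypothesis eps_z : forall k, eps k <= a * z ^+ k.
Hypothesis w_eps : forall k, w k * eps k <= a * z ^+ k.

Let w0 k : 0 <= w k. Proof. exact: sqrtr_ge0. Qed.

Lemma entropy_family (e : R) : 0 < e ->
  (sqrte (metric_entropy family_union e) <=
   \sum_(j <oo) (w j * \1_(`]0%R, eps j]%classic : set R) e)%:E)%E.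
Proof.
move=> e0.
have [k0 k0e] : exists k, eps k < e.
  have : a * z ^+ n @[n --> \oo] --> 0.
    by apply: cvg_geometric; rewrite ger0_norm// ltW.
  move=> /cvgrPdist_lt/(_ e e0)[n _ ne]; exists n.
  apply: le_lt_trans (eps_z n) _; have := ne n (leqnn n).
  by rewrite /= sub0r normrN; apply: le_lt_trans; exact: ler_norm.
have ex : exists k, eps k < e by exists k0.
(* With [k] least, the levels below [k] are exactly those whose indicator is 1 at [e]: the finite
   sum of the [w j] is then a partial sum of the series. *)
case: (ex_minnP ex) => k ke kmin.
have jk (j : 'I_k) : e <= eps j.
  by rewrite leNgt; apply/negP => /kmin; rewrite leqNgt ltn_ord.
have cov := @covering_family e k e0 (fun j kj => le_lt_trans (eps_decr kj) ke).
pose u j : \bar R := (w j * \1_(`]0%R, eps j]%classic : set R) e)%:E.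
have u0 j : (0 <= u j)%E by rewrite lee_fin mulr_ge0.
apply: (@le_trans _ _ (\sum_(0 <= j < k) u j)%E); last first.
  by apply: nneseries_lim_ge => j _ _; exact: u0.
rewrite big_mkord (eq_bigr (fun j : 'I_k => (w j)%:E)); last first.
  move=> j _; rewrite /u indicE mem_set ?mulr1//=.
  by rewrite in_itv /= e0 jk.
rewrite sumEFin.
pose p := \prod_(j < k) #|J j|.+1.
have p0 : (0 < p%:R :> R) by rewrite ltr0n prodn_gt0.
have p1 : (1 <= p%:R :> R) by rewrite ler1n prodn_gt0.
apply: (@le_trans _ _ (sqrte (lne p%:R%:E))).
  rewrite lee_sqrt ?lne_ge0 ?lee_fin// lee_lne//; rewrite in_itv /= leey andbT.
    by apply: le_ereal_inf_tmp => _ [n _ <-]; rewrite lee_fin.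
  by rewrite lee_fin ltW.
rewrite lne_EFin//= lee_fin /p (ln_prod_nat R (fun j => #|J j|)).
by apply: (@sqrtr_sum_le _ (fun j => ln #|J j|.+1%:R)) => j; rewrite ln_ge0// ler1n.
Qed.

(** Integrating the previous bound termwise over ]0,1], the indicator of []0, eps j]] contributes at
    most [eps j]; there remains the series of the [w j * eps j]. *)
Lemma entropy_integral_family :
  (\int[lebesgue_measure]_(e in `]0%R, 1%R]) sqrte (metric_entropy family_union e)
     < +oo)%E.
Proof.
apply: le_lt_trans.
  apply: nonneg_le_integral; first by move=> x _; exact: sqrte_ge0.
  move=> e /=; rewrite in_itv /= => /andP[e0 _]; exact: entropy_family.
rewrite integral_nneseries//; last 2 first.
- by move=> n; apply/measurable_EFinP; apply: measurable_funM.
- by move=> n x _; rewrite lee_fin mulr_ge0.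
rewrite (@le_lt_trans _ _ (\sum_(j <oo) (w j * eps j)%:E)%E)//.
  apply: lee_nneseries => [n _ _|n _]; first by apply: integral_ge0 => x _; rewrite lee_fin mulr_ge0.
  under eq_integral do rewrite EFinM.
  rewrite ge0_integralZl ?lee_fin//; last first.
    by apply/measurable_EFinP; exact: measurable_indic.
  rewrite integral_indic// EFinM lee_wpmul2l ?lee_fin//.
  have -> : (eps n)%:E = lebesgue_measure (`]0%R, eps n]%classic : set R).
    by rewrite lebesgue_measure_itv /= lte_fin eps_gt0 oppr0 adde0.
  by apply: le_measure; rewrite ?inE//; exact: measurableI.
apply: (nneseries_geometric_lty a0 z0 z1) => n; rewrite w_eps andbT.
by rewrite mulr_ge0// ltW.
Qed.

End concentrating_families.

(** * Failure of tightness *)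

Section sup_norm_space.
Variables (R : realType) (d : nat) (F : set (cube_borel R d)).

(** The easy half of Arzelà-Ascoli at one point. Each [f] in [K] has a sup-norm ball of radius
    [eta / 3] on which one [delta] works; the near-covering form of compactness makes [delta]
    uniform. *)
Lemma compact_equicontinuous (K : set (C_space F)) (A0 : F) (eta : R) :
  compact K -> 0 < eta ->
  exists2 delta : R, 0 < delta & forall f : C_space F, K f ->
    forall A : F, rho (set_val A0) (set_val A) < delta ->
    `|(f : continuousType F R) A - (f : continuousType F R) A0| < eta.
Proof.
move=> /compact_near_coveringP cK eta0.
have eta3 : 0 < eta / 3 by rewrite divr_gt0.
pose Q (delta : R) (f : C_space F) := forall A : F,
  rho (set_val A0) (set_val A) < delta ->
  `|(f : continuousType F R) A - (f : continuousType F R) A0| < eta.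
have cKQ : \forall delta \near 0^'+, K `<=` Q delta.
  apply: cK => f Kf.
  have cf : continuous (f : continuousType F R) by exact: cts_fun.
  have : nbhs A0 [set A : F | `|(f : continuousType F R) A0 -
      (f : continuousType F R) A| < eta / 3].
    exact: (cf A0 (ball ((f : continuousType F R) A0) (eta / 3)) (nbhsx_ballx _ _ eta3)).
  rewrite nbhsE => -[_ [[U oU <-] /= UA0] UfA].
  have /nbhs_ballP[r /= r0 rU] := open_nbhs_nbhs (conj oU UA0).
  exists ([set g : C_space F | forall A : F, `|(f : continuousType F R) A -
      (g : continuousType F R) A| < eta / 3], [set delta : R | delta < r]).
    split=> /=; first by apply/C_space_nbhsP; exists (eta / 3).
    exact: nbhs_right_lt.
  move=> [g delta] /= [fg dr] A A0A.
  have fA : `|(f : continuousType F R) A0 - (f : continuousType F R) A| < eta / 3.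
    by apply: UfA; apply: rU; exact: lt_trans dr.
  have := fg A; have := fg A0; move: fA.
  move: (_ A0) (_ A) (_ A0) (_ A) => a b a' b'.
  rewrite !ltr_norml => /andP[? ?] /andP[? ?] /andP[? ?].
  by apply/andP; split; lra.
have [delta [/= delta0 KQ]] := filter_ex (filterI (nbhs_right_gt (0 : R)) cKQ).
by exists delta.
Qed.

Lemma normalized_sum_ext (x y : 'rV[int]_d -> R) n :
  (forall i, x (@pos_index d n i) = y (pos_index i)) ->
  normalized_sum F x n = normalized_sum F y n.
Proof.
move=> xy; apply/continuousEP => A /=; congr (_ * _).
by apply: eq_bigr => i _; rewrite xy.
Qed.

Lemma measurable_normalized_sum s n (K : set (C_space F)) :
  measurable ((fun w => normalized_sum F (fun k => @field R d s k w) n) @^-1` K).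
Proof.
(* Rebuilds a field, null off the grid, from the finite vector of coordinates on which the sum
   depends. The preimage of any [K] becomes an event on that vector. *)
pose x (c : {ffun {ffun 'I_d -> 'I_n} -> nat}) (k : 'rV[int]_d) : R :=
  if [pick i | pos_index i == k] is Some i then amplitude R s (c i) else 0.
rewrite (_ : _ @^-1` K = [set w | [set c | K (normalized_sum F (x c) n)]
    [ffun i : {ffun 'I_d -> 'I_n} => coord (pos_index i) w]]).
  exact: measurable_coords.
apply/funext => w; rewrite /preimage /mkset; congr K.
apply: normalized_sum_ext => i; rewrite /x; case: pickP => [j /eqP/pos_index_inj->|].
  by rewrite ffunE.
by move/(_ i); rewrite eqxx.
Qed.

End sup_norm_space.

(** * Parameters of the family and its entropy *)

Section counterexample.
Variables (R : realType) (d q : nat).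
Hypothesis d0 : (0 < d)%N.

Local Notation s := (2 * q).+1.

(* [scale k] is one less than the dyadic side of the [k]-th grid, because cells
   are indexed by ['I_n.+1]. *)
Definition scale (k : nat) : nat := (2 ^ (2 * s * k)).-1.
Definition blocks (k : nat) : nat := 2 ^ (2 * q * (d * k)).
Definition block_size (k : nat) : nat := 2 ^ (s.+1 * (d * k)).

Local Notation idx k := {ffun 'I_d -> 'I_(scale k).+1}.

(** Ordered and with repetitions allowed: this only enlarges the family, and the cardinal is an
    exact power of 2. *)
Definition selection (k : nat) : finType := (blocks k).-tuple (idx k).
Definition selected_cells (k : nat) (t : selection k) : cube_borel R d :=
  grid_set R t.
Definition radius (k : nat) : R := 2^-1 ^+ (q.+1 * (d * k)).
Definition bad_family := family_union (cube0 R d) selected_cells.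

Lemma scaleS k : (scale k).+1 = (2 ^ (2 * s * k))%N.
Proof. by rewrite prednK// expn_gt0. Qed.

Lemma card_idx k : #|{: idx k}| = (2 ^ (2 * s * (d * k)))%N.
Proof. by rewrite card_ffun !card_ord scaleS -expnM; congr (_ ^ _)%N; ring. Qed.

Lemma card_idx_blocks k : #|{: idx k}| = (blocks k * block_size k)%N.
Proof. by rewrite card_idx -expnD; congr (_ ^ _)%N; ring. Qed.

Lemma card_selection k : #|selection k| = (2 ^ (2 * s * (d * k) * blocks k))%N.
Proof. by rewrite card_tuple card_idx -expnM. Qed.

Lemma rho_selected k (t : selection k) : rho (cube0 R d) (selected_cells t) <= radius k.
Proof.
rewrite -(@ler_pXn2r _ 2)// ?nnegrE ?sqrtr_ge0 ?exprn_ge0//.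
apply: le_trans (rho_grid _ _) _; rewrite size_tuple scaleS !natrX.
rewrite ler_pdivrMr ?exprn_gt0// -!exprM exprVn.
rewrite [leRHS]mulrC ler_pdivlMr ?exprn_gt0// -exprD.
by rewrite le_eqVlt; apply/orP; left; apply/eqP; congr (_ ^+ _); ring.
Qed.

Lemma leq_dim k : (k <= d * k)%N.
Proof. exact: leq_pmull. Qed.

Lemma radius_gt0 k : 0 < radius k.
Proof. by rewrite exprn_gt0// invr_gt0. Qed.

Lemma radius_decr j k : (j <= k)%N -> radius k <= radius j.
Proof.
move=> jk; rewrite ler_wiXn2l ?invr_ge0//; last by rewrite !leq_mul2l jk !orbT.
by rewrite invf_le1// ler1n.
Qed.

Lemma radius_le k : radius k <= 2^-1 ^+ k.
Proof.
rewrite ler_wiXn2l ?invr_ge0//; first by rewrite invf_le1// ler1n.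
by rewrite (leq_trans (leq_dim k))// leq_pmull.
Qed.

(** The constants are those of [selection_entropy], as [entropy_integral_family] wants one majorant
    for both bounds. *)
Lemma radius_geometric k : radius k <= (6 * s)%:R * (3 / 4) ^+ k.
Proof.
apply: le_trans (radius_le k) _.
apply: (@le_trans _ _ ((3 / 4) ^+ k)).
  by rewrite lerXn2r ?nnegrE ?invr_ge0// ?divr_ge0//; lra.
by rewrite ler_peMl ?exprn_ge0 ?divr_ge0// ler1n.
Qed.

(** The linear factor coming from the logarithm is absorbed so that [2^-l] still leaves
    [(3/4)^l]. *)
Lemma linear_le_expr l : (s * l).+1%:R <= (2 * s)%:R * (3 / 2) ^+ l :> R.
Proof.
elim: l => [|l IH]; first by rewrite muln0 expr0 mulr1 ler1n.
have -> : (s * l.+1).+1%:R = (s * l).+1%:R + s%:R :> R.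
  by rewrite -natrD; congr _%:R; ring.
apply: le_trans (lerD IH (lexx _)) _.
have e1 : 1 <= (3 / 2) ^+ l :> R by rewrite exprn_ege1//; lra.
rewrite exprS natrM; set e := _ ^+ l in e1 *.
have s0 : 0 <= s%:R :> R by rewrite ler0n.
have : s%:R <= s%:R * e by rewrite ler_peMr.
lra.
Qed.

Lemma ln_card_selection k :
  ln (#|selection k|.+1%:R : R) <= (3 * (s * (d * k)).+1%:R * 2 ^+ (q * (d * k))) ^+ 2.
Proof.
set l := (d * k)%N; set x : R := (s * l).+1%:R.
have x1 : 1 <= x by rewrite ler1n.
have ln4 : ln (4 : R) <= 3.
  rewrite (_ : 4 = 1 + 3 :> R); last by ring.
  by apply: le_ln1Dx; lra.
(* The cardinal is [4 ^ (s * l * blocks k)]; one more factor 4 absorbs the successor. *)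
have : #|selection k|.+1%:R <= 4 ^+ (s * l * blocks k).+1 :> R.
  rewrite card_selection -/l -mulnA -mulnA expnM -natrX ler_nat.
  rewrite (_ : (2 ^ 2)%N = 4%N)// mulnA.
  set e := (s * l * blocks k)%N; rewrite expnS.
  have : (0 < 4 ^ e)%N by rewrite expn_gt0.
  lia.
rewrite -ler_ln ?posrE ?exprn_gt0// => /le_trans; apply.
rewrite lnXn// -[ln 4 *+ _]mulr_natl.
have bx : (s * l * blocks k).+1%:R <= x * (2 ^+ (q * l)) ^+ 2.
  rewrite -exprM -natrX -natrM ler_nat /blocks -/l mulSn.
  rewrite (_ : (q * l * 2 = 2 * q * l)%N); last by ring.
  by rewrite -add1n leq_add// expn_gt0.
apply: (@le_trans _ _ (x * (2 ^+ (q * l)) ^+ 2 * 3)).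
  by apply: ler_pM => //; rewrite ln_ge0// ler1n.
rewrite [leRHS]exprMn mulrAC ler_wpM2r ?exprn_ge0//.
nra.
Qed.

(** The factor [2 ^+ (q * (d * k))] cancels against the radius, leaving a linear factor times
    [2^-(d k)]. *)
Lemma selection_entropy k :
  Num.sqrt (ln (#|selection k|.+1%:R : R)) * radius k <= (6 * s)%:R * (3 / 4) ^+ k.
Proof.
apply: (@le_trans _ _
    ((3 * (s * (d * k)).+1%:R * 2 ^+ (q * (d * k))) * radius k)).
  rewrite ler_wpM2r ?(ltW (radius_gt0 _))//.
  apply: le_trans (ler_wsqrtr (ln_card_selection k)) _.
  by rewrite sqrtr_sqr ger0_norm// !mulr_ge0// exprn_ge0.
rewrite /radius [(q.+1 * _)%N]mulSn addnC exprD exprVn.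
rewrite mulrA mulfK ?expf_neq0// ?pnatr_eq0//.
apply: (@le_trans _ _ (3 * ((2 * s)%:R * (3 / 2) ^+ (d * k)) * 2^-1 ^+ (d * k))).
  by rewrite ler_wpM2r ?exprn_ge0 ?invr_ge0// ler_wpM2l// linear_le_expr.
have -> : 3 * ((2 * s)%:R * (3 / 2) ^+ (d * k)) * 2^-1 ^+ (d * k) =
    (6 * s)%:R * (3 / 4) ^+ (d * k) :> R.
  rewrite (_ : 3 / 4 = 3 / 2 * 2^-1 :> R); last by field.
  by rewrite [in RHS]exprMn !natrM; ring.
rewrite ler_wpM2l// ler_wiXn2l//; last exact: leq_dim.
lra.
Qed.

Lemma bad_family_entropy :
  (\int[lebesgue_measure]_(e in `]0%R, 1%R]) sqrte (metric_entropy bad_family e)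
     < +oo)%E.
Proof.
apply: (entropy_integral_family rho_selected radius_decr radius_gt0
  (ler0n _ _) _ _ radius_geometric selection_entropy); lra.
Qed.

Lemma bad_family_regular A : bad_family A -> lebesgue_regular A.
Proof.
move=> [->|[k [t ->]]]; last exact: regular_grid.
rewrite /lebesgue_regular closure0 interior0 setD0; exact: measure0.
Qed.

End counterexample.

(** * Hitting every block with high probability *)

Section not_tight.
Variables (R : realType) (d q : nat).
Hypothesis d0 : (0 < d)%N.

Local Notation s := (2 * q).+1.
Local Notation idx k := {ffun 'I_d -> 'I_(scale q k).+1}.
Notation P := (@unit_lebesgue R).
Local Notation F := (@bad_family R d q).

(** Blocks are consecutive runs of the enumeration of the grid; for [b] and [c] in range the default
    of [nth] is never reached, by [card_idx_blocks]. *)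
Definition block_cell (k b c : nat) : idx k :=
  nth [ffun=> ord0] (enum {: idx k}) (b * block_size d q k + c).

Lemma block_cell_inj k b b' c c' :
  (b < blocks d q k)%N -> (b' < blocks d q k)%N ->
  (c < block_size d q k)%N -> (c' < block_size d q k)%N ->
  block_cell k b c = block_cell k b' c' -> b = b' /\ c = c'.
Proof.
move=> bm bm' cM cM' /eqP.
have lt_idx x y : (x < blocks d q k)%N -> (y < block_size d q k)%N ->
    (x * block_size d q k + y < size (enum {: idx k}))%N.
  move=> xm yM; rewrite -cardE card_idx_blocks//.
  apply: (@leq_trans (x * block_size d q k + block_size d q k)).
    by rewrite ltn_add2l.
  by rewrite -mulSnr leq_mul2r xm orbT.
rewrite nth_uniq ?lt_idx ?enum_uniq// => /eqP e.
have M0 : (0 < block_size d q k)%N by exact: leq_ltn_trans cM.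
split.
  have := congr1 (divn^~ (block_size d q k)) e.
  by rewrite !divnMDl// !divn_small// !addn0.
by have := congr1 (modn^~ (block_size d q k)) e; rewrite !modnMDl !modn_small.
Qed.

Definition block_index (k b : nat) : seq 'rV[int]_d :=
  [seq pos_index (block_cell k b c) | c <- iota 0 (block_size d q k)].

(** The digit [(s * (d * k)).*2] codes the value [2 ^+ (d * k)], see [amplitude_double]. *)
Definition missed (k b : nat) : set (measurableTypeR R) :=
  \bigcap_(i in [set` block_index k b]) (coord i @^-1` ~` [set (s * (d * k)).*2]).

Lemma measurable_missed k b : measurable (missed k b).
Proof. by apply: fin_bigcap_measurable => // i _; exact: measurable_coord. Qed.

(** With [l = d k], independence gives [(1 - p) ^ M <= exp (- p M)], where [p = 2^(-s l) / 4] and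
    [M = 2^((s + 1) l)], so that [p M = 2^l / 4]. *)
Lemma missed_le k b : (b < blocks d q k)%N ->
  (P (missed k b) <= (expR (- (2 ^+ (d * k) / 4)))%:E)%E.
Proof.
move=> bm.
have ui : uniq (block_index k b).
  rewrite map_inj_in_uniq ?iota_uniq// => c c'; rewrite !mem_iota /= => cM cM'.
  by move=> /pos_index_inj /block_cell_inj[].
rewrite /missed (@coord_indep R _ _ _ ui).
pose p : R := 2^-1 ^+ (s * (d * k)) / 4.
rewrite (eq_bigr (fun=> (1 - p)%:E)); last first.
  move=> i _; rewrite -preimage_setC.
  apply: (etrans (probability_setC P (@measurable_coord R _ i _))).
  by rewrite [X in (_ - X)%E](@coord_law R _ i) doubleK.
rewrite prodEFin lee_fin big_const_seq count_predT iter_mulr_1 size_map size_iota.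
have p0 : 0 <= p by rewrite divr_ge0// exprn_ge0// invr_ge0.
have p1 : p <= 1.
  rewrite ler_pdivrMr// mul1r (@le_trans _ _ 1)//; last by lra.
  by rewrite exprn_ile1 ?invr_ge0// invf_le1// ler1n.
apply: (@le_trans _ _ (expR (- p) ^+ block_size d q k)).
  by rewrite lerXn2r ?nnegrE ?subr_ge0 ?expR_ge0//; exact: expR_ge1Dx.
rewrite -expRM_natl ler_expR mulrN lerN2.
rewrite /p /block_size natrX mulrA ler_wpM2r ?invr_ge0//.
rewrite mulSnr [(_ + d * k)%N]addnC exprD exprVn -mulrA mulfV ?mulr1//.
Qed.

(** One good cell is chosen in each block; cells of distinct blocks differ, whence [uniq t]. *)
Lemma hit_selection k (w : measurableTypeR R) :
  (forall b, (b < blocks d q k)%N -> ~ missed k b w) ->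
  exists2 t : selection d q k, uniq t &
    forall i, i \in (t : seq _) -> field R s (pos_index i) w = 2 ^+ (d * k).
Proof.
move=> hit.
have hitc (b : 'I_(blocks d q k)) : exists c, (c < block_size d q k)%N /\
    coord (pos_index (block_cell k b c)) w = (s * (d * k)).*2.
  apply: contrapT => nc; apply: (hit b (ltn_ord b)) => _ /mapP[c cM ->] /= wc.
  by apply: nc; exists c; rewrite mem_iota in cM.
pose cc b := sval (cid (hitc b)).
have ccP b : (cc b < block_size d q k)%N /\
    coord (pos_index (block_cell k b (cc b))) w = (s * (d * k)).*2.
  by rewrite /cc; case: cid.
exists [tuple block_cell k b (cc b) | b < blocks d q k].
  rewrite /= map_inj_uniq ?enum_uniq// => b b'.
  by move=> /block_cell_inj[]; rewrite ?(proj1 (ccP _))// => /val_inj.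
move=> i /mapP[b _ ->]; rewrite -(amplitude_double R (s := s))//.
by rewrite -(proj2 (ccP b)).
Qed.

(** With [l = d k], the sum is [2^(2 q l) * 2^l = 2^(s l)], exactly the side of the grid to the
    power [d / 2]. *)
Lemma normalized_sum_selected k (t : selection d q k) (x : 'rV[int]_d -> R) :
  uniq t -> (forall i, i \in (t : seq _) -> x (pos_index i) = 2 ^+ (d * k)) ->
  (scale q k).+1%:R `^ (- (d%:R / 2)) *
    partial_sum x (scale q k).+1 (selected_cells R t) = 1.
Proof.
move=> ut xt; rewrite partial_sum_grid// (eq_big_seq _ xt).
rewrite big_const_seq count_predT iter_addr_0 size_tuple.
have -> : (scale q k).+1%:R `^ (- (d%:R / 2)) = (2 ^+ (s * (d * k)))^-1 :> R.
  rewrite powRN scaleS natrX; congr (_^-1).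
  rewrite (_ : (2 * s * k = s * k * 2)%N); last by ring.
  rewrite exprM -[_ ^+ 2]powR_mulrn ?exprn_ge0// -powRrM.
  rewrite mulrCA mulfV ?pnatr_eq0// mulr1 powR_mulrn ?exprn_ge0// -exprM.
  by congr (_ ^+ _); ring.
rewrite -[_ *+ blocks d q k]mulr_natr /blocks natrX -exprD (_ : (_ + _ = s * (d * k))%N); last by ring.
by rewrite mulVf// expf_neq0// pnatr_eq0.
Qed.

Lemma large_scale (delta : R) : 0 < delta -> exists k,
  radius R d q k < delta /\
  (blocks d q k)%:R * expR (- (2 ^+ (d * k) / 4)) <= 2^-1 :> R.
Proof.
move=> delta0.
(* As [2^k > k], the first term gives [2^-k < delta], and the second gives
   [y = 2^(d k) >= 2 * 4^s * s!], hence [exp (y / 4) >= (y / 4)^s / s! >= 2 y^(2 q)]. *)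
pose k := maxn (Num.truncn delta^-1).+1 (2 * 4 ^ s * s`!).
exists k; split.
  apply: le_lt_trans (radius_le R q d0 k) _.
  rewrite exprVn invf_plt ?posrE ?exprn_gt0//.
  apply: lt_le_trans (truncnS_gt _) _; rewrite -natrX ler_nat.
  by rewrite (leq_trans (leq_maxl _ _ : (_ <= k)%N))// ltnW// ltn_expl.
set y : R := 2 ^+ (d * k).
have y0 : 0 < y by rewrite exprn_gt0.
have yk : 2 * 4 ^+ s * s`!%:R <= y.
  rewrite -natrX -!natrM /y -natrX ler_nat.
  apply: (leq_trans (leq_maxr _ _ : (_ <= k)%N)).
  by rewrite (leq_trans (leq_dim d0 k))// ltnW// ltn_expl.
have -> : (blocks d q k)%:R = y ^+ (2 * q) :> R.
  by rewrite /blocks natrX -exprM; congr (_ ^+ _); ring.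
rewrite expRN ler_pdivrMr ?expR_gt0//.
have := @expR_ge1Dxn R (y / 4) (2 * q) (divr_ge0 (ltW y0) (ler0n _ _)).
have : 2 * y ^+ (2 * q) <= (y / 4) ^+ s / s`!%:R.
  rewrite expr_div_n -mulrA -invfM.
  rewrite ler_pdivlMr ?mulr_gt0 ?exprn_gt0 ?ltr0n ?fact_gt0// [y ^+ s]exprS.
  have -> (Y A B : R) : 2 * Y * (A * B) = 2 * A * B * Y by ring.
  by rewrite ler_wpM2r// exprn_ge0// ltW.
set e := expR _; set u := _ / s`!%:R; lra.
Qed.

Lemma bad_family_not_tight :
  ~ tight P (fun n w => normalized_sum F (fun k => field R s k w) n.+1).
Proof.
(* The compact set obtained has probability at least 3/4 for every [n]; at one well-chosen scale the
   bound 1/2 will contradict this. *)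
move=> /(_ 4^-1) []; first by rewrite invr_gt0.
move=> K [cK PK].
have F0 : F (cube0 R d) by left.
pose A0 : F := SigSub (mem_set F0).
have [delta delta0 Kdelta] := compact_equicontinuous A0 cK ltr01.
have [k [rk mk]] := large_scale delta0.
pose Y w := normalized_sum F (fun i => field R s i w) (scale q k).+1.
(* If no block is missed, the selected union is within [delta] of the empty set, yet the normalized
   sums there differ by exactly 1, against equicontinuity with [eta = 1]. *)
have sub : Y @^-1` K `<=` \big[setU/set0]_(b < blocks d q k) missed k b.
  move=> w /= Kw; rewrite -bigcup_mkord; apply: contrapT => nm.
  have [b bm mb|t ut tw] := @hit_selection k w.
    by apply: nm; exists b.
  have Ft : F (selected_cells R t) by right; exists k, t.
  pose At : F := SigSub (mem_set Ft).
  have /(_ At) := Kdelta _ Kw.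
  rewrite /= (le_lt_trans (rho_selected R t) rk) => /(_ isT).
  rewrite /normalized_sum_fun /= normalized_sum_selected// partial_sum0 mulr0.
  by rewrite subr0 normr1 ltxx.
have mY : measurable (Y @^-1` K) by exact: measurable_normalized_sum.
have : (P (Y @^-1` K) <= (2^-1)%:E)%E.
  apply: le_trans (content_subadditive P _ mY sub) _.
    by move=> b _; exact: measurable_missed.
  apply: (@le_trans _ _
      (\sum_(b < blocks d q k) (expR (- (2 ^+ (d * k) / 4)))%:E)%E).
    by apply: lee_sum => b _; exact: missed_le.
  by rewrite sumEFin lee_fin sumr_const card_ord -[_ *+ blocks d q k]mulr_natl.
(* The process is indexed by [n.+1], so index [scale q k] is the grid of side [(scale q k).+1]. *)
move=> /(le_trans (PK (scale q k))).
by rewrite lee_fin; lra.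
Qed.

End not_tight.

Theorem theorem3 (R : realType) (d : nat) (hd : (1 <= d)%N) (p : R) (hp : 0 < p) :
  exists (disp : measure_display) (T : measurableType disp)
    (P : probability T R) (X : 'rV[int]_d -> {RV P >-> R})
    (F : set (cube_borel R d)),
    [/\ stationary X,
        independent_rvs X,
        forall k, symmetric_rv (X k) &
        ('E_P[(fun w => `|X 0 w| `^ p)%R] < +oo)%E] /\
    [/\ forall A : cube_borel R d, F A -> lebesgue_regular A,
        (\int[lebesgue_measure]_(e in `]0%R, 1%R]) sqrte (metric_entropy F e)
           < +oo)%E &
        ~ tight P (fun n w => normalized_sum F (fun k => X k w) n.+1)].
Proof.
(* The tail index [s = 2 q + 1] exceeds [p]; being odd, it makes the exponent [(s + 1) / 2 = q + 1]
   of the radius an integer. *)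
pose q := Num.truncn p.
have pq : p < (2 * q).+1%:R.
  apply: lt_le_trans (truncnS_gt _) _.
  by rewrite ler_nat ltnS leq_pmull.
exists _, (measurableTypeR R), (@unit_lebesgue R), (field R (2 * q).+1),
  (@bad_family R d q).
split; split.
- exact: field_stationary.
- exact: field_independent.
- exact: field_symmetric.
- exact: field_integrable.
- exact: bad_family_regular.
- exact: bad_family_entropy.
- exact: bad_family_not_tight.
Qed.
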